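(* Let $w$ be a generalised left eigenvector of rank $m\ge1$ of $C$ corresponding to the eigenvalue $\lambda$. (1) If $|\lambda|<R$, then $wF(N)=wK+(\log_qN)^mw\vartheta_m+O(N^{\log_qR})$. (2) If $|\lambda|=R$, then $wF(N)=wK+(\log_qN)^mw\vartheta_m+O(N^{\log_qR}(\log N)^m)$. (3) If $|\lambda|>R$, then there are $1$-periodic continuous functions $\Phi_k:\mathbb{R}\to\mathbb{C}^d$, $0\le k<m$, such that $$wF(N)=wK+(\log_qN)^mw\vartheta_m+N^{\log_q\lambda}\sum_{0\le k<m}(\log_qN)^k\Phi_k(\{\log_qN\})$$ for $N\ge q^{m-1}$. Each $\Phi_k$ is Hölder continuous with any exponent smaller than $\log_q(|\lambda|/R)$. If, additionally, the left eigenvector $w(C-\lambda I)^{m-1}$ of $C$ is a left eigenvector of each of $A_0,\dots,A_{q-1}$ associated with the eigenvalue $1$, then $\Phi_{m-1}(u)=\frac{1}{q^{m-1}(m-1)!}w(C-qI)^{m-1}$ is constant. Moreover, $wK=0$ if $\lambda=1$ and $w\vartheta_m=0$ if $\lambda\ne1$.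
   Context: Let $q\ge2$, $d\ge1$ be integers and $A_0,\dots,A_{q-1}\in\mathbb{C}^{d\times d}$. Define $f(0)=I$ and, for $n\ge1$ with $q$-ary expansion $r_{\ell-1}\dots r_0$ (digits $r_j\in\{0,\dots,q-1\}$, $r_{\ell-1}\ne0$), $f(n)=A_{r_0}A_{r_1}\cdots A_{r_{\ell-1}}$ (equivalently $f(qn+r)=A_rf(n)$ for $qn+r\ne0$). Let $F(N)=\sum_{0\le n<N}f(n)$. Fix a norm on $\mathbb{C}^d$ and its induced matrix norm; vectors $w$ are row vectors acting by $w\mapsto wM$. $C=\sum_{0\le r<q}A_r$. $\rho=\inf_\ell\sup\{\|A_{r_1}\cdots A_{r_\ell}\|^{1/\ell}: r_i\in\{0,\dots,q-1\}\}$ is the joint spectral radius. If the matrices have the finiteness property (there is $\ell>0$ with $\rho=\sup\{\|A_{r_1}\cdots A_{r_\ell}\|^{1/\ell}\}$), set $R=\rho$; otherwise fix $R>\rho$ such that no eigenvalue $\lambda$ of $C$ satisfies $\rho<|\lambda|\le R$. Choose a regular $T$ with $TCT^{-1}=J$ in Jordan form; let $D$ be diagonal with $j$th entry $1$ if the $j$th diagonal entry of $J$ is $\ne1$ and $0$ otherwise; $C'=T^{-1}DJT$; $K=T^{-1}DT(I-C')^{-1}(I-A_0)$; for $m\ge1$, $\vartheta_m=\frac1{m!}T^{-1}(I-D)T(C-I)^{m-1}(I-A_0)$. $\log$ is the principal logarithm, $\log_q z=\log z/\log q$, $\{z\}$ the fractional part. Implicit $O$-constants depend on $q,d,A_0,\dots,A_{q-1},R$.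 *)

(* Defs.v *)
From HB Require Import structures.
From mathcomp Require Import all_boot all_order all_algebra.
From mathcomp Require Import all_classical all_reals all_analysis.
From mathcomp Require Import complex.
Set Implicit Arguments.
Unset Strict Implicit.
Unset Printing Implicit Defensive.
Import Order.TTheory GRing.Theory Num.Theory.
Local Open Scope classical_set_scope.
Local Open Scope ring_scope.

Section Defs.
Variable R : realType.
Local Notation C := R[i].

Definition cabs (z : C) : R := Normc.normc z.

Definition ndigits (q n : nat) : nat := if n == 0%N then 0%N else (trunc_log q n).+1.
Definition digit (q n j : nat) : nat := ((n %/ q ^ j) %% q)%N.

Variable d : nat.

(** f(n) = A_{r_0} A_{r_1} ... A_{r_{l-1}}, f(0) = I  (only A_0..A_{q-1} are used) *)
Definition fseq (q : nat) (A : nat -> 'M[C]_d) (n : nat) : 'M[C]_d :=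
  \big[mulmx/1%:M]_(j < ndigits q n) A (digit q n j).

Definition Fsum (q : nat) (A : nat -> 'M[C]_d) (N : nat) : 'M[C]_d :=
  \sum_(n < N) fseq q A n.

Definition Cmat (q : nat) (A : nat -> 'M[C]_d) : 'M[C]_d := \sum_(r < q) A r.

Definition is_vnorm (nv : 'rV[C]_d -> R) : Prop :=
  [/\ (forall v, 0 <= nv v),
      (forall v, nv v = 0 -> v = 0),
      (forall (a : C) v, nv (a *: v) = cabs a * nv v) &
      (forall u v, nv (u + v) <= nv u + nv v)].

Definition opnorm (nv : 'rV[C]_d -> R) (M : 'M[C]_d) : R :=
  sup [set nv (v *m M) | v in [set v | nv v <= 1]].

Definition prodw (A : nat -> 'M[C]_d) (l : nat) (s : 'I_l -> nat) : 'M[C]_d :=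
  \big[mulmx/1%:M]_(i < l) A (s i).

Definition jsr_l (q : nat) (nv : 'rV[C]_d -> R) (A : nat -> 'M[C]_d) (l : nat) : R :=
  sup [set x | exists s : 'I_l -> 'I_q,
               x = opnorm nv (prodw A (fun i => nat_of_ord (s i))) `^ (l%:R^-1)].

Definition jsr (q : nat) (nv : 'rV[C]_d -> R) (A : nat -> 'M[C]_d) : R :=
  inf [set jsr_l q nv A l | l in [set l : nat | (0 < l)%N]].

Definition finiteness (q : nat) (nv : 'rV[C]_d -> R) (A : nat -> 'M[C]_d) : Prop :=
  exists l : nat, (0 < l)%N /\ jsr q nv A = jsr_l q nv A l.

Definition is_jordan (J : 'M[C]_d) : Prop :=
  (forall i j : 'I_d, i != j -> nat_of_ord j != (nat_of_ord i).+1 -> J i j = 0) /\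
  (forall i j : 'I_d, nat_of_ord j = (nat_of_ord i).+1 ->
      J i j = 0 \/ (J i j = 1 /\ J i i = J j j)).

Definition Dmat (J : 'M[C]_d) : 'M[C]_d :=
  diag_mx (\row_j (if J j j == 1 then 0 else 1)).

Definition Kmat (T J A0 : 'M[C]_d) : 'M[C]_d :=
  let C' := invmx T *m Dmat J *m J *m T in
  invmx T *m Dmat J *m T *m invmx (1%:M - C') *m (1%:M - A0).

Definition theta (T J Cm A0 : 'M[C]_d) (m : nat) : 'M[C]_d :=
  (m`!%:R)^-1 *: (invmx T *m (1%:M - Dmat J) *m T *m (Cm - 1%:M) ^+ (m.-1)
                    *m (1%:M - A0)).

End Defs.

Section CDefs.
Variable R : realType.
Local Notation C := R[i].
Local Open Scope complex_scope.

Definition logq (q : nat) (x : R) : R := ln x / ln q%:R.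

Definition fracpart (x : R) : R := x - (Num.floor x)%:~R.

(** principal argument in (-pi, pi] (for z <> 0) *)
Definition carg (z : C) : R :=
  if (0 <= complex.Im z)%R then acos (complex.Re z / cabs z)%R
  else (- acos (complex.Re z / cabs z))%R.

Definition cLog (z : C) : C := (ln (cabs z)) +i* (carg z).

Definition cexp (z : C) : C := (expR (complex.Re z))%:C * ((cos (complex.Im z)) +i* (sin (complex.Im z))).

Definition rpowc (x : R) (z : C) : C := cexp (z * (ln x)%:C).

Definition RC (x : R) : C := x%:C.

End CDefs.

(* Main.v *)
Require Import Defs.
From HB Require Import structures.
From mathcomp Require Import all_boot all_order all_algebra.
From mathcomp Require Import all_classical all_reals all_analysis.
From mathcomp Require Import complex.
From mathcomp Require Import ring lra zify.
Import Order.TTheory GRing.Theory Num.Theory.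
Import numFieldNormedType.Exports.
Local Open Scope ring_scope.

(** Let V be the matrix with rows w (C - lam)^k, so that V C = Lambda V for a
    single Jordan block Lambda.  Splitting off the last digit gives
      V F(qN + r) = Lambda V F(N) + V (I - A_0) + V B_r f(N),   B_r = A_0 + ... + A_{r-1}.
    The inhomogeneity V (I - A_0) is absorbed by a function sigma of log_q N
    which is constant (equal to V K) if lam <> 1 and polynomial if lam = 1, and
    which accounts for the terms w K and (log_q N)^m w theta_m.  The difference
    P(N) = V F(N) - sigma(log_q N) satisfies P(qN) = Lambda P(N) exactly, while
    P(qN + r) - P(qN) and P(N + 1) - P(N) are O(r^(log_q N)) for every r > R,
    and for r = R if |lam| <= R, in which case iterating this bounds P(N).
    If |lam| > R, the renormalised values Lambda^(-n) P(floor(q^(n + t)))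
    converge geometrically to a function g with g(t + 1) = Lambda g(t), and
    Lambda^(-t) g(t) is the periodic fluctuation.  Comparing g(x) and g(y) with
    the n-th approximants, q^(-n) ~ |x - y|, yields Holder continuity. *)

(** The radius R, called [Rb] in the code, enters through one fact: for some length l, all products
    of l matrices have norm at most R^l. Cutting longer products into blocks of length l bounds them
    by a constant times R^n with no epsilon lost, as (1) and (2) require. Powers of Lambda carry a
    polynomial factor. An intermediate base mu absorbs it, between |lam| and R in (1) and between r
    and |lam| in (3); in (2) it turns into powers of log N. Real powers Lambda^t are needed because
    log_q N is real. With S the shift matrix, the binomial series of (1 + S/lam)^t terminates, and
    rewriting its coefficients, which are polynomials in t, in powers of t yields the factors (log_q
    N)^k and the functions Phi_k. For lam = 1 only the leading coefficient of sigma is w theta_m.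
    The lower powers of log_q N go into the O-term in (1) and (2), and into Phi_k in (3), where
    N^(log_q lam) = 1. Because P(qN) = Lambda P(N) is exact, the approximants at t = log_q N are
    eventually constant; hence (3) is an equality and not an asymptotic formula. *)

Set Implicit Arguments.
Unset Strict Implicit.

(** * Norms *)

Section ComplexAbs.
Variable R : realType.
Implicit Types z u v : R[i].

Lemma cabs_ge0 z : 0 <= cabs z.
Proof. by case: z => a b; rewrite sqrtr_ge0. Qed.

Lemma cabs0 : cabs (0 : R[i]) = 0.
Proof. exact: Normc.normc0. Qed.

Lemma cabs1 : cabs (1 : R[i]) = 1.
Proof. exact: Normc.normc1. Qed.

Lemma cabsM u v : cabs (u * v) = cabs u * cabs v.
Proof. exact: Normc.normcM. Qed.

Lemma cabsV u : cabs u^-1 = (cabs u)^-1.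
Proof. exact: Normc.normcV. Qed.

Lemma cabsN u : cabs (- u) = cabs u.
Proof. exact: normcN. Qed.

Lemma cabsD u v : cabs (u + v) <= cabs u + cabs v.
Proof. exact: le_normcD. Qed.

Lemma cabs_eq0 u : cabs u = 0 -> u = 0.
Proof. exact: Normc.eq0_normc. Qed.

Lemma cabs_gt0 u : (0 < cabs u) = (u != 0).
Proof.
rewrite lt_def cabs_ge0 andbT; congr (~~ _).
by apply/eqP/eqP => [/cabs_eq0|->]; last exact: cabs0.
Qed.

Lemma cabsX u n : cabs (u ^+ n) = cabs u ^+ n.
Proof. by elim: n => [|n IHn]; rewrite ?cabs1// !exprS cabsM IHn. Qed.

Lemma cabs_real (x : R) : cabs (RC x) = `|x|.
Proof. by rewrite /cabs /RC /= expr0n addr0 sqrtr_sqr. Qed.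

Lemma RC_nat n : RC (n%:R : R) = n%:R.
Proof. exact: rmorph_nat. Qed.

Lemma cabs_nat n : cabs (n%:R : R[i]) = n%:R.
Proof. by rewrite -RC_nat cabs_real normr_nat. Qed.

Lemma cabs_sum (I : Type) (r : seq I) (P : pred I) (F : I -> R[i]) :
  cabs (\sum_(i <- r | P i) F i) <= \sum_(i <- r | P i) cabs (F i).
Proof.
elim/big_rec2: _ => [|i x y _ IH]; first by rewrite cabs0.
by apply: le_trans (cabsD _ _) _; rewrite lerD2l.
Qed.

Lemma Re_le_cabs z : `|complex.Re z| <= cabs z.
Proof.
case: z => a b; rewrite /cabs /= -sqrtr_sqr ler_sqrt ?addr_ge0 ?sqr_ge0//.
by rewrite lerDl sqr_ge0.
Qed.

Lemma Im_le_cabs z : `|complex.Im z| <= cabs z.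
Proof.
case: z => a b; rewrite /cabs /= -sqrtr_sqr ler_sqrt ?addr_ge0 ?sqr_ge0//.
by rewrite lerDr sqr_ge0.
Qed.

Lemma cabs_le_ReIm z : cabs z <= `|complex.Re z| + `|complex.Im z|.
Proof.
case: z => a b; rewrite /cabs /=.
rewrite -[leRHS]ger0_norm ?addr_ge0// -sqrtr_sqr ler_sqrt ?sqr_ge0//.
rewrite sqrrD !real_normK ?num_real// lerD2r lerDl.
by rewrite mulrn_wge0// mulr_ge0.
Qed.

End ComplexAbs.

Section MatrixNorm.
Variable R : realType.

(** [nv] measures row vectors only, whereas most estimates concern rectangular matrices of chain
    vectors; the entrywise l1 norm is submultiplicative for all shapes. *)
Definition mxn (p n : nat) (M : 'M[R[i]]_(p, n)) : R :=
  \sum_i \sum_j cabs (M i j).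

Lemma mxn_ge0 p n (M : 'M[R[i]]_(p, n)) : 0 <= mxn M.
Proof. by do 2!apply: sumr_ge0 => ? _; exact: cabs_ge0. Qed.

Lemma mxn0 p n : mxn (0 : 'M[R[i]]_(p, n)) = 0.
Proof. by rewrite /mxn big1// => i _; rewrite big1// => j _; rewrite mxE cabs0. Qed.

Lemma mxnD p n (M N : 'M[R[i]]_(p, n)) : mxn (M + N) <= mxn M + mxn N.
Proof.
rewrite /mxn -big_split ler_sum// => i _; rewrite -big_split ler_sum// => j _.
by rewrite mxE cabsD.
Qed.

Lemma mxnZ p n a (M : 'M[R[i]]_(p, n)) : mxn (a *: M) = cabs a * mxn M.
Proof.
rewrite /mxn mulr_sumr; apply: eq_bigr => i _; rewrite mulr_sumr.
by apply: eq_bigr => j _; rewrite mxE cabsM.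
Qed.

Lemma mxnN p n (M : 'M[R[i]]_(p, n)) : mxn (- M) = mxn M.
Proof. by do 2!apply: eq_bigr => ? _; rewrite mxE cabsN. Qed.

Lemma mxnB p n (M N : 'M[R[i]]_(p, n)) : mxn (M - N) <= mxn M + mxn N.
Proof. by rewrite -[mxn N]mxnN mxnD. Qed.

Lemma mxnC p n (M N : 'M[R[i]]_(p, n)) : mxn (M - N) = mxn (N - M).
Proof. by rewrite -mxnN opprB. Qed.

Lemma mxn_entry p n (M : 'M[R[i]]_(p, n)) i j : cabs (M i j) <= mxn M.
Proof.
rewrite /mxn (bigD1 i)//= (bigD1 j)//= -addrA lerDl.
by rewrite addr_ge0 ?sumr_ge0// => *; rewrite ?sumr_ge0// => *; rewrite cabs_ge0.
Qed.

Lemma mxn_row p n (M : 'M[R[i]]_(p, n)) i : mxn (row i M) <= mxn M.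
Proof.
rewrite /mxn big_ord1 [leRHS](bigD1 i)//=.
rewrite (eq_bigr (fun j => cabs (M i j))) => [|j _]; last by rewrite mxE.
by rewrite lerDl sumr_ge0// => *; rewrite sumr_ge0// => *; rewrite cabs_ge0.
Qed.

Lemma mxnM p n k (M : 'M[R[i]]_(p, n)) (N : 'M[R[i]]_(n, k)) : mxn (M *m N) <= mxn M * mxn N.
Proof.
rewrite {1 2}/mxn mulr_suml ler_sum// => i _.
apply: (@le_trans _ _ (\sum_j \sum_l cabs (M i l) * cabs (N l j))).
  apply: ler_sum => j _; rewrite mxE; apply: le_trans (cabs_sum _ _ _) _.
  by apply: ler_sum => l _; rewrite cabsM.
rewrite exchange_big mulr_suml ler_sum// => l _.
rewrite -mulr_sumr ler_wpM2l ?cabs_ge0//.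
by rewrite /mxn (bigD1 l)//= lerDl !sumr_ge0// => *; rewrite sumr_ge0// => *; rewrite cabs_ge0.
Qed.

Lemma mxn_sum p n (I : Type) (r : seq I) (P : pred I) (F : I -> 'M[R[i]]_(p, n)) :
  mxn (\sum_(i <- r | P i) F i) <= \sum_(i <- r | P i) mxn (F i).
Proof.
elim/big_rec2: _ => [|i x y _ IH]; first by rewrite mxn0.
by apply: le_trans (mxnD _ _) _; rewrite lerD2l.
Qed.

Lemma mxn_eq0 p n (M : 'M[R[i]]_(p, n)) : mxn M <= 0 -> M = 0.
Proof.
move=> M0; apply/matrixP => i j; rewrite mxE; apply: cabs_eq0.
by apply/le_anti; rewrite cabs_ge0 (le_trans (mxn_entry _ _ _) M0).
Qed.

End MatrixNorm.

Section NormEquivalence.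
Local Open Scope classical_set_scope.
Local Open Scope ring_scope.
Variables (R : realType) (d : nat) (nv : 'rV[R[i]]_d -> R).
Hypothesis nvP : is_vnorm nv.

Lemma vnorm_ge0 v : 0 <= nv v. Proof. by case: nvP. Qed.
Lemma vnorm_eq0 v : nv v = 0 -> v = 0. Proof. by case: nvP => _ + _ _; exact. Qed.
Lemma vnormZ a v : nv (a *: v) = cabs a * nv v. Proof. by case: nvP. Qed.
Lemma vnormD u v : nv (u + v) <= nv u + nv v. Proof. by case: nvP. Qed.
Lemma vnorm0 : nv 0 = 0.
Proof. by rewrite -(scale0r (0 : 'rV[R[i]]_d)) vnormZ cabs0 mul0r. Qed.
Lemma vnormN v : nv (- v) = nv v.
Proof. by rewrite -scaleN1r vnormZ cabsN cabs1 mul1r. Qed.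

Lemma vnorm_sum (I : Type) (r : seq I) (P : pred I) (F : I -> 'rV[R[i]]_d) :
  nv (\sum_(i <- r | P i) F i) <= \sum_(i <- r | P i) nv (F i).
Proof.
elim/big_rec2: _ => [|i x y _ IH]; first by rewrite vnorm0.
by apply: le_trans (vnormD _ _) _; rewrite lerD2l.
Qed.

Lemma vnorm_le_mxn : exists2 c, 0 < c & forall v, nv v <= c * mxn v.
Proof.
exists (1 + \sum_i nv (delta_mx 0 i)).
  by rewrite ltr_pwDl// sumr_ge0// => i _; exact: vnorm_ge0.
move=> v; rewrite {1}(row_sum_delta v); apply: le_trans (vnorm_sum _ _ _) _.
rewrite mulrC mulrDr mulr1 mulr_sumr ler_wpDl ?mxn_ge0// ler_sum// => i _.
by rewrite vnormZ ler_wpM2r ?vnorm_ge0// mxn_entry.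
Qed.

(** [cvec] and [rvec] identify C^d with R^(2d), where bounded closed sets are compact. *)
Let cvec (x : 'rV[R]_(d + d)) : 'rV[R[i]]_d :=
  \row_i (Complex (lsubmx x 0 i) (rsubmx x 0 i)).

Let rvec (v : 'rV[R[i]]_d) : 'rV[R]_(d + d) :=
  row_mx (\row_i complex.Re (v 0 i)) (\row_i complex.Im (v 0 i)).

Let rvecK v : cvec (rvec v) = v.
Proof.
by apply/rowP => i; rewrite mxE row_mxKl row_mxKr !mxE; case: (v 0 i).
Qed.

Let cvecZ a x : cvec (a *: x) = RC a *: cvec x.
Proof. by apply/rowP => i; rewrite !mxE /RC; apply/eqP; simpc. Qed.

Let mxn_cvec x : mxn (cvec x) <= (d%:R *+ 2) * `|x|.
Proof.
have entry i : `|x 0 i| <= `|x|.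
  rewrite [leRHS]/Num.norm /= mx_normrE; apply/bigmax_geP; right.
  by exists (0, i).
rewrite /mxn big_ord1 (@le_trans _ _ (\sum_(i < d) `|x| *+ 2))//; last first.
  rewrite sumr_const card_ord; suff -> : `|x| *+ 2 *+ d = d%:R *+ 2 * `|x| by [].
  by rewrite -[LHS]mulr_natr; ring.
apply: ler_sum => i _; rewrite mxE; apply: le_trans (cabs_le_ReIm _) _ => /=.
by rewrite !mxE mulr2n lerD.
Qed.

Let nvB u v : `|nv u - nv v| <= nv (u - v).
Proof.
rewrite ler_norml; apply/andP; split.
  rewrite lerNl opprB lerBlDr -(vnormN (u - v)) opprB.
  by apply: le_trans (vnormD _ _); rewrite subrK.
by rewrite lerBlDr; apply: le_trans (vnormD _ _); rewrite subrK.
Qed.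

Let cont_nv : continuous (fun x => nv (cvec x)).
Proof.
have [c c0 nvc] := vnorm_le_mxn.
move=> x; have nbhs_x : Filter (nbhs x) := @nbhs_filter 'rV[R]_(d + d) x.
apply/cvgrPdist_le => e e0.
have k0 : 0 < c * ((d%:R *+ 2) + 1) by rewrite mulr_gt0// ltr_wpDl// mulrn_wge0.
have nx : \forall y \near x, `|x - y| <= e / (c * (d%:R *+ 2 + 1)).
  by have /cvgrPdist_le/(_ _ (divr_gt0 e0 k0)) := @cvg_id 'rV[R]_(d + d) (nbhs x).
near=> y.
apply: le_trans (nvB _ _) _; apply: le_trans (nvc _) _.
have -> : cvec x - cvec y = cvec (x - y).
  by apply/rowP => i; rewrite !mxE; apply/eqP; rewrite eq_complex /= !eqxx.
apply: le_trans (ler_wpM2l (ltW c0) (mxn_cvec _)) _.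
have : `|x - y| <= e / (c * (d%:R *+ 2 + 1)) by near: y.
rewrite ler_pdivlMr// => h; apply: le_trans h.
rewrite mulrA mulrC ler_wpM2l// ler_wpM2l ?(ltW c0)//.
by rewrite lerDl.
Unshelve. all: by end_near. Qed.

(* The vectors of sup norm 1 form a compact set on which [nv] is continuous and
   does not vanish. *)
Lemma mxn_le_vnorm : exists2 c, 0 < c & forall v, mxn v <= c * nv v.
Proof.
pose S := [set x : 'rV[R]_(d + d) | `|x| = 1].
(* For [d = 0] there is no vector of norm 1, but then every vector is 0. *)
have [S0|/set0P[x0 Sx0]] := eqVneq S classical_sets.set0.
  exists 1 => // v; suff -> : v = 0 by rewrite mxn0 vnorm0 mulr0.
  rewrite -(rvecK v); have [->|rv0] := eqVneq (rvec v) 0.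
    by apply/rowP => i; rewrite !mxE.
  have : S (`|rvec v|^-1 *: rvec v).
    by rewrite /S /= normrZ ger0_norm ?invr_ge0// mulVf// normr_eq0.
  by rewrite S0.
have cptS : compact S.
  apply: bounded_closed_compact.
    by exists 1; split => // y y1 x /= ->; exact: ltW.
  have -> : S = (Num.norm : 'rV[R]_(d + d) -> R) @^-1` [set 1].
    by apply/seteqP; split.
  apply: closed_comp => [x _|]; last exact: closed_eq.
  exact: norm_continuous.
have [x Sx minx] : exists2 c, c \in S & forall t, t \in S -> nv (cvec c) <= nv (cvec t).
  apply: compact_EVT_min => //; first by exists x0.
  by apply: continuous_subspaceT; exact: cont_nv.
have nx0 : 0 < nv (cvec x).
  rewrite lt_def vnorm_ge0 andbT; apply/eqP => /vnorm_eq0 cx0.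
  have : x = 0.
    rewrite -(hsubmxK x) -[RHS]row_mx0; congr row_mx; apply/rowP => i;
      by move/rowP: cx0 => /(_ i); rewrite !mxE => -[? ?].
  by move=> xe; move: Sx; rewrite inE /S /= xe normr0 => /eqP; rewrite eq_sym oner_eq0.
exists ((d%:R *+ 2 + 1) / nv (cvec x)).
  by rewrite divr_gt0// ltr_wpDl// mulrn_wge0.
move=> v; have [->|v0] := eqVneq v 0; first by rewrite mxn0 vnorm0 mulr0.
have rv0 : rvec v != 0.
  apply: contra_neq v0 => rv0; rewrite -(rvecK v) rv0.
  by apply/rowP => i; rewrite !mxE.
have rvp : 0 < `|rvec v| by rewrite normr_gt0.
have : nv (cvec x) <= nv (cvec (`|rvec v|^-1 *: rvec v)).
  by apply: minx; rewrite inE /S /= normrZ ger0_norm ?invr_ge0// mulVf// normr_eq0.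
have -> : cvec (`|rvec v|^-1 *: rvec v) = RC (`|rvec v|^-1) *: v.
  by rewrite cvecZ rvecK.
rewrite vnormZ cabs_real ger0_norm ?invr_ge0// mulrC ler_pdivlMr// mulrC => h.
rewrite mulrAC ler_pdivlMr//.
apply: (@le_trans _ _ ((d%:R *+ 2 + 1) * `|rvec v| * nv (cvec x))); last first.
  by rewrite -mulrA ler_wpM2l// addr_ge0// mulrn_wge0.
rewrite ler_wpM2r ?vnorm_ge0// -{1}(rvecK v); apply: le_trans (mxn_cvec _) _.
by rewrite ler_wpM2r// lerDl.
Qed.

End NormEquivalence.

(** * Real powers of unipotent matrices *)

Section BinomialPolynomials.
Variable F : numFieldType.

(* The binomial coefficient [t choose k] as a polynomial in [t]. *)
Fixpoint binp (k : nat) : {poly F} :=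
  if k is j.+1 then (j.+1%:R)^-1 *: (binp j * ('X - (j%:R)%:P)) else 1.

Lemma binp0 t : (binp 0).[t] = 1. Proof. by rewrite hornerC. Qed.

Lemma binpS k t : (binp k.+1).[t] = (binp k).[t] * (t - k%:R) / k.+1%:R.
Proof. by rewrite [binp _]/= hornerZ hornerM hornerXsubC mulrC. Qed.

Lemma binpSM k t : k.+1%:R * (binp k.+1).[t] = (binp k).[t] * (t - k%:R).
Proof. by rewrite binpS mulrC divfK// pnatr_eq0. Qed.

Lemma binp_at0 k : (binp k.+1).[0] = 0.
Proof. by elim: k => [|k IHk]; rewrite binpS ?IHk ?subrr ?mulr0 !mul0r. Qed.

Lemma binp_pascal k t : (binp k.+1).[t + 1] = (binp k.+1).[t] + (binp k).[t].
Proof.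
elim: k => [|k IHk]; first by rewrite !binpS !binp0; field.
have k0 : (k.+2%:R : F) != 0 by rewrite pnatr_eq0.
apply: (mulfI k0); rewrite mulrDr !binpSM IHk.
have := binpSM k t; rewrite -[in k.+2%:R]natr1 -!natr1 => e.
have -> : ((binp k.+1).[t] + (binp k).[t]) * (t + 1 - (k%:R + 1)) =
  (binp k.+1).[t] * (t - k%:R) + (binp k).[t] * (t - k%:R) by ring.
by rewrite -e; ring.
Qed.

Lemma binp_vandermonde n s t :
  \sum_(i < n.+1) (binp i).[s] * (binp (n - i)).[t] = (binp n).[s + t].
Proof.
elim: n => [|n IHn]; first by rewrite big_ord1 !binp0 mul1r.
have n0 : (n.+1%:R : F) != 0 by rewrite pnatr_eq0.
apply: (mulfI n0); rewrite binpSM -IHn mulr_sumr.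
(* Writing n + 1 = i + (n + 1 - i) lets [binpSM] lower one of the two indices in each term. *)
have -> : \sum_(i < n.+2) n.+1%:R * ((binp i).[s] * (binp (n.+1 - i)).[t]) =
  \sum_(i < n.+2) i%:R * (binp i).[s] * (binp (n.+1 - i)).[t] +
  \sum_(i < n.+2) (binp i).[s] * ((n.+1 - i)%:R * (binp (n.+1 - i)).[t]).
  rewrite -big_split; apply: eq_bigr => i _ /=; rewrite natrB -1?ltnS//; ring.
rewrite big_ord_recl /= mul0r mul0r add0r [X in _ + X]big_ord_recr /=.
rewrite subnn mul0r mulr0 addr0 -big_split mulr_suml; apply: eq_bigr => i _ /=.
rewrite /bump /= add1n subSS binpSM subSn -1?ltnS// binpSM natrB -1?ltnS//; ring.
Qed.

Lemma size_binp k : (size (binp k) <= k.+1)%N.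
Proof.
elim: k => [|k IHk] /=; first by rewrite size_poly1.
apply: leq_trans (size_scale_leq _ _) _.
by apply: leq_trans (size_polyMleq _ _) _; rewrite size_XsubC addn2.
Qed.

(** Origin of 1/m! in theta_m and of 1/(m-1)! in the constant Phi_(m-1). *)
Lemma lead_binp k : (binp k)`_k = (k`!%:R)^-1.
Proof.
elim: k => [|k IHk]; first by rewrite /= coef1 fact0 invr1.
rewrite /= coefZ mulrBr coefB coefMX coefMC /= IHk.
by rewrite (nth_default _ (size_binp k)) mul0r subr0 factS natrM invfM.
Qed.

Lemma binp_expand n k t : (k < n)%N ->
  (binp k).[t] = \sum_(i < n) (binp k)`_i * t ^+ i.
Proof. by move=> kn; rewrite (@horner_coef_wide _ n)// (leq_trans (size_binp k)). Qed.

Variables (m : nat) (X : 'M[F]_m.+1).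
Hypothesis Xnil : X ^+ m.+1 = 0.

(* The binomial series of [(1 + X) ^ t], finite because [X] is nilpotent. *)
Definition unipow (t : F) : 'M[F]_m.+1 := \sum_(k < m.+1) (binp k).[t] *: X ^+ k.

Let trunc t : {poly F} := \poly_(k < m.+1) (binp k).[t].

Let unipowE t : unipow t = horner_mx X (trunc t).
Proof.
rewrite /trunc poly_def rmorph_sum /=; apply: eq_bigr => k _.
by rewrite -mul_polyC rmorphM rmorphXn /= horner_mx_C horner_mx_X -mulmxE mul_scalar_mx.
Qed.

(** Since X^(m+1) = 0, evaluation at X sees a polynomial only modulo X^(m+1). Identities between the
    matrices [unipow t] thus reduce to coefficients, and additivity in t to Vandermonde's
    convolution. *)
Let horner_take p : horner_mx X (take_poly m.+1 p) = horner_mx X p.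
Proof.
rewrite -[in RHS](poly_take_drop m.+1 p) rmorphD rmorphM rmorphXn /= horner_mx_X.
by rewrite Xnil mulr0 addr0.
Qed.

Lemma unipowD s t : unipow (s + t) = unipow s * unipow t.
Proof.
rewrite !unipowE -rmorphM -[RHS]horner_take; congr horner_mx.
apply/polyP => k; rewrite coef_poly coef_take_poly; case: ltnP => // km.
rewrite coefM -binp_vandermonde; apply: eq_bigr => i _.
by rewrite !coef_poly !ifT// (leq_ltn_trans _ km)// ?leq_subr// -ltnS.
Qed.

Lemma unipow0 : unipow 0 = 1.
Proof.
rewrite /unipow big_ord_recl /= hornerC scale1r expr0 big1 ?addr0// => i _.
by rewrite binp_at0 scale0r.
Qed.

Lemma unipow1 : unipow 1 = 1 + X.
Proof.
have b2 k : (binp k.+2).[1] = 0.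
  by elim: k => [|k IHk]; rewrite binpS ?IHk ?mul0r// subrr mulr0 mul0r.
have b1 : (binp 1).[1] = 1 by rewrite binpS binp0; field.
have -> : 1 + X = horner_mx X (1 + 'X) by rewrite rmorphD rmorph1 /= horner_mx_X.
rewrite unipowE -[RHS]horner_take.
congr horner_mx; apply/polyP => k; rewrite coef_poly coef_take_poly coefD coef1 coefX.
case: ltnP => // _; case: k => [|[|k]]; first by rewrite binp0 addr0.
  by rewrite b1 add0r.
by rewrite b2 addr0.
Qed.

End BinomialPolynomials.

Section Shift.
Variables (F : fieldType) (m : nat).

Definition shiftmx : 'M[F]_m := \matrix_(i, j) (j == i.+1 :> nat)%:R.

Lemma row_shiftmx n (G : 'M[F]_(m, n)) (i j : 'I_m) :
  j = i.+1 :> nat -> row i (shiftmx *m G) = row j G.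
Proof.
move=> ji; rewrite row_mul; apply/rowP => l; rewrite !mxE (bigD1 j)//=.
rewrite !mxE ji eqxx mul1r big1 ?addr0// => k kj; rewrite !mxE.
by case: eqP => [e|_]; [move: kj; rewrite -val_eqE /= e ji eqxx|rewrite mul0r].
Qed.

Lemma row_shiftmx_max n (G : 'M[F]_(m, n)) (i : 'I_m) :
  m = i.+1 -> row i (shiftmx *m G) = 0.
Proof.
move=> mi; rewrite row_mul; apply/rowP => l; rewrite !mxE big1// => k _.
by rewrite !mxE; case: eqP => [e|_]; [have := ltn_ord k; rewrite e -mi ltnn|rewrite mul0r].
Qed.
End Shift.

Lemma row_shiftmxX (F : fieldType) m n (G : 'M[F]_(m, n)) (i : 'I_m) k :
  row i (shiftmx F m ^+ k *m G) =
  if insub (i + k)%N is Some j then row j G else 0.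
Proof.
elim: k G => [|k IHk] G.
  rewrite expr0 mul1mx addn0; case: insubP => [j _ ji|]; last by rewrite ltn_ord.
  by congr row; apply: val_inj.
rewrite exprSr -mulmxE -mulmxA IHk /=; case: insubP => [j _ ji|ik].
  case: insubP => [j' _ j'i|]; first by apply: row_shiftmx; move: j'i ji => /= -> ->; rewrite addnS.
  rewrite -leqNgt => mi; apply: row_shiftmx_max.
  by apply/eqP; rewrite eqn_leq ltn_ord andbT; move: ji => /= ->; rewrite -addnS.
by case: insubP => // j jm _; move: ik; rewrite (leq_trans _ jm)// addnS ltnS.
Qed.

Lemma shiftmx_nilp (F : fieldType) m : shiftmx F m ^+ m = 0.
Proof.
apply/row_matrixP => i; rewrite -[_ ^+ _]mulmx1 row_shiftmxX row0.
by case: insubP => //= j ? ?; exfalso; lia.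
Qed.

(** * The matrices K and theta *)

Section Jordan.
Variables (R : realType) (d : nat).
Local Notation C := R[i].
Implicit Types (J T M : 'M[C]_d).

Lemma upper_unitmx M : (forall i j : 'I_d, (j < i)%N -> M i j = 0) ->
  (forall i, M i i != 0) -> M \in unitmx.
Proof.
move=> Mup Mdiag; rewrite unitmxE -det_tr det_trig.
  by rewrite unitfE; apply/prodf_neq0 => i _; rewrite mxE.
by apply/is_trig_mxP => i j ij; rewrite mxE Mup.
Qed.

(** With [b j] = [p (J j j)] this is the projection onto the Jordan blocks whose eigenvalue
    satisfies [p]; [Dmat J] is the case of eigenvalues other than 1. *)
Definition boolmx (b : 'I_d -> bool) : 'M[C]_d := diag_mx (\row_j (b j)%:R).

Lemma boolmxE b i j : boolmx b i j = (b i && (i == j))%:R.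
Proof. by rewrite !mxE andbC; case: eqP => [->|_]; rewrite ?mulr1n ?mulr0n. Qed.

Lemma boolmx_mulE b M i j : (boolmx b *m M) i j = (b i)%:R * M i j.
Proof. by rewrite mul_diag_mx !mxE. Qed.

Lemma mul_boolmxE b M i j : (M *m boolmx b) i j = M i j * (b j)%:R.
Proof. by rewrite mul_mx_diag !mxE. Qed.

Lemma boolmx_idem b : boolmx b *m boolmx b = boolmx b.
Proof. by apply/matrixP => i j; rewrite boolmx_mulE boolmxE; case: (b i); rewrite ?mul1r ?mul0r. Qed.

Lemma boolmxC b : boolmx (fun j => ~~ b j) = 1%:M - boolmx b.
Proof.
apply/matrixP => i j; rewrite !mxE; case: (i == j); rewrite ?mulr0n ?mulr1n ?subrr//.
by case: (b i); rewrite /= ?subrr ?subr0.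
Qed.

Lemma is_jordan_upper J : is_jordan J -> forall i j : 'I_d, (j < i)%N -> J i j = 0.
Proof.
move=> [J0 _] i j ji; apply: J0; first by rewrite -val_eqE /=; lia.
by apply/eqP; lia.
Qed.

(** A superdiagonal 1 joins equal diagonal entries only, so the projection never cuts through a
    Jordan block. *)
Lemma jordan_comm_boolmx J (p : C -> bool) : is_jordan J ->
  boolmx (fun j => p (J j j)) *m J = J *m boolmx (fun j => p (J j j)).
Proof.
move=> [J0 J1]; apply/matrixP => i j; rewrite boolmx_mulE mul_boolmxE mulrC.
have [->//|ij] := eqVneq i j.
have [e|ne] := eqVneq (nat_of_ord j) (nat_of_ord i).+1; last by rewrite J0// !mul0r.
by case: (J1 _ _ e) => [->|[_ ->]//]; rewrite !mul0r.
Qed.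

(* [D (J - lam) + (1 - D)] is invertible and acts on the range of [D] as [J - lam]. *)
Lemma jordan_gen_eigen0 J (p : C -> bool) lam k (u : 'rV[C]_d) : is_jordan J ->
  (forall z, p z -> z != lam) ->
  u *m boolmx (fun j => p (J j j)) = u -> u *m (J - lam%:M) ^+ k = 0 -> u = 0.
Proof.
move=> Jj pl; set D := boolmx _.
have DJ : D *m (J - lam%:M) = (J - lam%:M) *m D.
  by rewrite mulmxBr mulmxBl scalar_mxC jordan_comm_boolmx.
pose M := D *m (J - lam%:M) + boolmx (fun j => ~~ p (J j j)).
have Mu : M \in unitmx.
  apply: upper_unitmx => [i j ji|i]; rewrite mxE boolmx_mulE boolmxE !mxE.
    have -> : (i == j) = false by rewrite -val_eqE /= gtn_eqF.
    by rewrite (is_jordan_upper Jj ji) andbF mulr0n subrr mulr0 add0r.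
  rewrite eqxx andbT mulr1n; case: (boolP (p (J i i))) => [/pl|_] /=.
    by rewrite mul1r addr0 subr_eq0.
  by rewrite mul0r add0r oner_eq0.
elim: k u => [|k IHk] u uD; first by rewrite expr0 mulmx1.
rewrite exprS -mulmxE mulmxA => uJ.
have u0 : u *m (J - lam%:M) = 0 by apply: IHk => //; rewrite -mulmxA -DJ mulmxA uD.
have /(congr1 (mulmx^~ (invmx M))) : u *m M = 0.
  rewrite /M mulmxDr mulmxA uD u0 add0r boolmxC mulmxBr mulmx1 -/D uD.
  exact: subrr.
by rewrite mul0mx mulmxK.
Qed.

Lemma Dmat_boolmx J : Dmat J = boolmx (fun j => J j j != 1).
Proof.
by congr diag_mx; apply/rowP => j; rewrite !mxE; case: eqP.
Qed.

Variables (T J Cm A0 : 'M[C]_d).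
Hypotheses (Tu : T \in unitmx) (TCJ : T *m Cm *m invmx T = J) (Jj : is_jordan J).

Let E := invmx T *m Dmat J *m T.

Let CE : Cm = invmx T *m J *m T.
Proof. by rewrite -TCJ !mulmxA mulVmx// mul1mx mulmxKV. Qed.

Let conjM (M N : 'M[C]_d) :
  (invmx T *m M *m T) *m (invmx T *m N *m T) = invmx T *m (M *m N) *m T.
Proof. by rewrite !mulmxA (mulmxK Tu). Qed.

Let conjX lam k : (Cm - lam%:M) ^+ k = invmx T *m (J - lam%:M) ^+ k *m T.
Proof.
elim: k => [|k IHk]; first by rewrite !expr0 mulmx1 mulVmx.
rewrite !exprS IHk -!mulmxE -conjM; congr (_ *m _).
by rewrite mulmxBr mulmxBl -CE scalar_mxC -mulmxA mulVmx// mulmx1.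
Qed.

(** [E] is the spectral projection of C for the eigenvalues other than 1. *)
Lemma gen_eigen_proj lam k (w : 'rV[C]_d) : w *m (Cm - lam%:M) ^+ k = 0 ->
  w *m E = if lam == 1 then 0 else w.
Proof.
rewrite conjX !mulmxA => /(congr1 (mulmx^~ (invmx T))) /=.
rewrite mul0mx (mulmxK Tu) => w0.
pose u := w *m invmx T.
have wE : w = u *m T by rewrite mulmxKV.
(* [u] has no component in blocks with eigenvalue other than [lam]. This is applied to the predicate
   z != 1 when [lam] = 1, and to its complement otherwise. *)
have main (p : C -> bool) : (forall z, p z -> z != lam) ->
    u *m boolmx (fun j => p (J j j)) = 0.
  move=> pl; apply: (jordan_gen_eigen0 (p := p) (k := k) Jj pl).
    by rewrite -mulmxA boolmx_idem.
  rewrite -mulmxA; have -> : boolmx (fun j => p (J j j)) *m (J - lam%:M) ^+ k =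
      (J - lam%:M) ^+ k *m boolmx (fun j => p (J j j)).
    apply: (commrX k); rewrite /GRing.comm -!mulmxE mulmxBr mulmxBl scalar_mxC.
    by rewrite jordan_comm_boolmx.
  by rewrite mulmxA w0 mul0mx.
rewrite /E ?mulmxA -/u Dmat_boolmx; case: eqP => [l1|/eqP l1].
  by rewrite (main (fun z => z != 1)) ?mul0mx// => z; rewrite l1.
have := main (fun z => ~~ (z != 1)); rewrite boolmxC mulmxBr mulmx1.
move=> /(_ _)/subr0_eq <-; first by rewrite mulmxKV.
by move=> z; rewrite negbK => /eqP ->; rewrite eq_sym.
Qed.

Let EC : E *m Cm = Cm *m E.
Proof. by rewrite CE /E !conjM Dmat_boolmx (jordan_comm_boolmx (fun z => z != 1)). Qed.

Let C' := invmx T *m Dmat J *m J *m T.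

Let C'E : C' = E *m Cm.
Proof. by rewrite CE /E conjM /C' !mulmxA. Qed.

Let EE : E *m E = E.
Proof. by rewrite /E conjM Dmat_boolmx boolmx_idem. Qed.

(** D removes the eigenvalue 1 from J: the triangular matrix 1 - D J has diagonal entries 1, or 1 -
    J_jj with J_jj != 1. *)
Let C'unit : 1%:M - C' \in unitmx.
Proof.
have -> : 1%:M - C' = invmx T *m (1%:M - Dmat J *m J) *m T.
  by rewrite mulmxBr mulmx1 mulmxBl (mulVmx Tu) !mulmxA.
rewrite !unitmx_mul unitmx_inv Tu andbT /=; apply: upper_unitmx => [i j ji|i];
  rewrite Dmat_boolmx mxE [X in _ + X]mxE boolmx_mulE !mxE.
  have -> : (i == j) = false by rewrite -val_eqE /= gtn_eqF.
  by rewrite (is_jordan_upper Jj ji) mulr0 subr0.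
rewrite eqxx mulr1n; have [->|J1] := eqVneq (J i i) 1.
  by rewrite mul0r subr0 oner_eq0.
by rewrite mul1r subr_eq0 eq_sym.
Qed.

Lemma KmatE : Kmat T J A0 = E *m invmx (1%:M - C') *m (1%:M - A0).
Proof. by []. Qed.

(** On row vectors fixed by [E], K acts as (1 - C)^(-1) (1 - A_0). Hence V K is a constant solution
    of sigma = Lambda sigma + V (1 - A_0). *)
Lemma Kmat_fixpoint lam k (w : 'rV[C]_d) : lam != 1 -> w *m (Cm - lam%:M) ^+ k = 0 ->
  w *m Kmat T J A0 = w *m Cm *m Kmat T J A0 + w *m (1%:M - A0).
Proof.
move=> l1 /gen_eigen_proj; rewrite (negbTE l1) => wE.
apply/eqP; rewrite -subr_eq0 opprD addrA subr_eq0; apply/eqP.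
move: EE EC C'E C'unit wE; rewrite KmatE.
move: (E) (C') => E0 D0 E0E0 E0C D0E D0unit wE0.
rewrite !mulmxA -!mulmxBl -[in RHS]wE0.
suff -> : (w - w *m Cm) *m E0 = w *m E0 *m (1%:M - D0) by rewrite (mulmxK D0unit).
by rewrite mulmxBl mulmxBr mulmx1 D0E mulmxA -(mulmxA w E0 E0) E0E0 -!mulmxA E0C.
Qed.

Lemma Kmat_eigen1 k (w : 'rV[C]_d) : w *m (Cm - 1%:M) ^+ k = 0 -> w *m Kmat T J A0 = 0.
Proof.
move=> /gen_eigen_proj; rewrite eqxx KmatE; move: (E) => E0 wE0.
by rewrite !mulmxA wE0 !mul0mx.
Qed.

Lemma thetaE k n (w : 'rV[C]_d) lam : w *m (Cm - lam%:M) ^+ k = 0 ->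
  w *m theta T J Cm A0 n =
  if lam == 1 then (n`!%:R)^-1 *: (w *m (Cm - 1%:M) ^+ n.-1 *m (1%:M - A0)) else 0.
Proof.
move=> /gen_eigen_proj wE; rewrite /theta -scalemxAr.
have -> : invmx T *m (1%:M - Dmat J) *m T = 1%:M - E.
  by rewrite mulmxBr mulmx1 mulmxBl (mulVmx Tu).
move: wE; move: (E) => E0 wE.
rewrite !mulmxA (mulmxBr w 1%:M) mulmx1 wE; case: eqP => _; first by rewrite subr0.
by rewrite subrr !mul0mx scaler0.
Qed.

End Jordan.

(** * The recursion for F *)

Section Recursion.
Variables (R : realType) (d q : nat) (A : nat -> 'M[R[i]]_d).
Hypothesis q2 : (2 <= q)%N.

Lemma ndigitsE n : (0 < n)%N -> ndigits q n = (trunc_log q n).+1.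
Proof. by rewrite /ndigits; case: n. Qed.

Lemma trunc_log_qDr N r : (r < q)%N -> (0 < N)%N ->
  trunc_log q (q * N + r) = (trunc_log q N).+1.
Proof.
move=> rq N0; apply: trunc_log_eq => //; have := trunc_log_bounds q2 N0 => /andP[lo hi].
rewrite expnS (leq_trans (n := q * N)) ?leq_mul2l ?lo ?orbT ?leq_addr//=.
rewrite expnS; apply: (@leq_trans (q * N.+1)%N); first by rewrite mulnS; lia.
by rewrite leq_mul2l hi orbT.
Qed.

Lemma ndigits_qDr N r : (r < q)%N -> (0 < q * N + r)%N ->
  ndigits q (q * N + r) = (ndigits q N).+1.
Proof.
move=> rq; case: (posnP N) => [->|Np] N0; rewrite ndigitsE//.
  rewrite muln0 add0n /ndigits eqxx /=; congr S; apply: trunc_log_eq => //; move: N0; by rewrite muln0 expn0 expn1 => ->.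
by rewrite trunc_log_qDr// ndigitsE.
Qed.

Lemma digit_qDr0 N r : (r < q)%N -> digit q (q * N + r) 0 = r.
Proof. by move=> rq; rewrite /digit expn0 divn1 mulnC modnMDl modn_small. Qed.

Lemma digit_qDrS N r j : (r < q)%N -> digit q (q * N + r) j.+1 = digit q N j.
Proof.
move=> rq; rewrite /digit expnS divnMA (mulnC q N) divnMDl ?(ltnW q2)//.
by rewrite (divn_small rq) addn0.
Qed.

Lemma fseq0 : fseq q A 0 = 1%:M.
Proof. by rewrite /fseq /ndigits eqxx big_ord0. Qed.

Lemma fseq_qDr N r : (r < q)%N -> (0 < q * N + r)%N ->
  fseq q A (q * N + r) = A r *m fseq q A N.
Proof.
move=> rq N0; rewrite /fseq ndigits_qDr// big_ord_recl digit_qDr0//; congr (_ *m _).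
by apply: eq_bigr => j _; rewrite /= /bump add1n digit_qDrS.
Qed.

Definition Bmat r : 'M[R[i]]_d := \sum_(s < r) A s.

Lemma Fsum_add N k : Fsum q A (N + k) = Fsum q A N + \sum_(r < k) fseq q A (N + r).
Proof. by rewrite /Fsum big_split_ord. Qed.

(** The rule f(qn + r) = A_r f(n) fails only at n = r = 0, where f(0) = 1 stands in place of A_0;
    this single term is the inhomogeneity 1 - A_0. It is part of the sum once there is at least one
    summand, hence the argument [N.+1]. *)
Lemma Fsum_q N : Fsum q A (q * N.+1) =
  Cmat q A *m Fsum q A N.+1 + (1%:M - A 0%N).
Proof.
elim: N => [|N IHN].
  rewrite muln1 /Fsum big_ord1 fseq0 mulmx1 /Cmat.
  pose z : 'I_q := Ordinal (ltnW q2).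
  rewrite (bigD1 z)//= [in RHS](bigD1 z)//= fseq0 [RHS]addrC addrA subrK.
  congr (_ + _); apply: eq_bigr => r; rewrite -val_eqE /= -lt0n => r0.
  by have := @fseq_qDr 0%N r (ltn_ord _); rewrite muln0 add0n fseq0 mulmx1; apply.
rewrite mulnS addnC Fsum_add IHN -(addn1 N.+1) Fsum_add big_ord1 addn0 mulmxDr.
rewrite -addrA -[RHS]addrA; congr (_ + _); rewrite addrC; congr (_ + _).
rewrite /Cmat mulmx_suml; apply: eq_bigr => r _.
by rewrite fseq_qDr// addn_gt0 muln_gt0 (ltnW q2).
Qed.

Lemma Fsum_qDr N r : (r < q)%N -> (0 < N)%N -> Fsum q A (q * N + r) =
  Cmat q A *m Fsum q A N + (1%:M - A 0%N) + Bmat r *m fseq q A N.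
Proof.
case: N => // N rq _; rewrite Fsum_add Fsum_q; congr (_ + _).
rewrite /Bmat mulmx_suml; apply: eq_bigr => s _.
by rewrite fseq_qDr// ?(ltn_trans (ltn_ord s))// addn_gt0 muln_gt0 (ltnW q2).
Qed.

End Recursion.

(** * Joint spectral radius *)

Section Growth.
Variable R : realType.

Lemma bernoulli (x : R) n : 0 <= x -> 1 + n%:R * x <= (1 + x) ^+ n.
Proof.
move=> x0; elim: n => [|n IHn]; first by rewrite mul0r addr0 expr0.
rewrite exprSr; apply: le_trans (ler_wpM2r _ IHn); last by rewrite addr_ge0.
rewrite -natr1; have : 0 <= n%:R * x * x by rewrite !mulr_ge0.
lra.
Qed.

(** For k > 0, Bernoulli's inequality for the k-th root y = 1 + e of x gives n + 1 <= (1 + 1/e) y^n;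
    the claim is the k-th power of this. *)
Lemma polynomial_le_geometric (x : R) k : 1 < x ->
  exists2 c, 0 < c & forall n, n.+1%:R ^+ k <= c * x ^+ n.
Proof.
move=> x1; case: k => [|k].
  exists 1 => // n; rewrite mul1r expr0; apply: exprn_ege1; exact: ltW.
have x0 : 0 < x by exact: lt_trans x1.
pose y := x `^ (k.+1%:R^-1).
have yx : y ^+ k.+1 = x.
  by rewrite -powR_mulrn ?powR_ge0// -powRrM mulVf ?pnatr_eq0// powRr1// ltW.
have y1 : 1 < y.
  rewrite ltNge; apply/negP => y1; move: x1; rewrite -yx ltNge => /negP; apply.
  by apply: exprn_ile1 => //; exact: powR_ge0.
have [e e0 ye] : exists2 e, 0 < e & y = 1 + e.
  by exists (y - 1); [rewrite subr_gt0|rewrite addrC subrK].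
exists ((1 + e^-1) ^+ k.+1); first by rewrite exprn_gt0// addr_gt0// invr_gt0.
move=> n; rewrite -yx -exprM mulnC exprM -exprMn.
have e1 : 0 < e^-1 by rewrite invr_gt0.
apply: lerXn2r; rewrite ?nnegrE//.
  by rewrite mulr_ge0 ?exprn_ge0 ?powR_ge0// addr_ge0// ltW.
rewrite ye; apply: (@le_trans _ _ ((1 + e^-1) * (1 + n%:R * e))); last first.
  by rewrite ler_wpM2l ?bernoulli ?addr_ge0 ?invr_ge0 ?ltW.
rewrite mulrDl mul1r [e^-1 * _]mulrDr mulr1 [n%:R * e]mulrC mulKf ?gt_eqF// -natr1.
have : 0 <= e * n%:R by rewrite mulr_ge0// ltW.
lra.
Qed.

Lemma geometric_unbounded (x c : R) : 1 < x -> exists n, c < x ^+ n.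
Proof.
move=> x1; have [k k0 hk] := polynomial_le_geometric 1 x1.
pose n := Num.bound (k * `|c|).
have hn : k * `|c| < n%:R by apply: archi_boundP; rewrite mulr_ge0// ltW.
exists n; apply: le_lt_trans (ler_norm c) _.
rewrite -(ltr_pM2l k0); apply: lt_le_trans (hk n); rewrite expr1.
by apply: lt_le_trans hn _; rewrite ler_nat.
Qed.

Lemma powR_ln (x y : R) : 0 < x -> x `^ y = expR (y * ln x).
Proof. by move=> x0; rewrite /powR gt_eqF. Qed.

End Growth.

Section JointSpectralRadius.
Variables (R : realType) (q d : nat) (A : nat -> 'M[R[i]]_d) (nv : 'rV[R[i]]_d -> R).
Hypothesis q2 : (2 <= q)%N.
Hypothesis nvP : is_vnorm nv.

(** Words are infinite digit sequences read up to length n, so that cutting a word is a shift of the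
    index. *)
Definition natprodw n (s : nat -> nat) := prodw A (fun i : 'I_n => s i).

Lemma natprodw0 s : natprodw 0 s = 1%:M. Proof. exact: big_ord0. Qed.

Let natprodwE n s : natprodw n s = \prod_(i < n) A (s i). Proof. by []. Qed.

Lemma natprodwD a b s :
  natprodw (a + b) s = natprodw a s *m natprodw b (fun i => s (a + i)%N).
Proof. by rewrite mulmxE !natprodwE big_split_ord. Qed.

Lemma natprodw1 s : natprodw 1 s = A (s 0%N).
Proof. by rewrite natprodwE big_ord1. Qed.

Lemma natprodw_ext n s t : (forall i, (i < n)%N -> s i = t i) ->
  natprodw n s = natprodw n t.
Proof. by move=> st; apply: eq_bigr => i _; rewrite st. Qed.

Lemma opnorm_has_ub : exists2 c, 0 < c &
  forall M v, nv (v *m M) <= c * mxn M * nv v.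
Proof.
have [c1 c10 h1] := vnorm_le_mxn nvP; have [c2 c20 h2] := mxn_le_vnorm nvP.
exists (c1 * c2); first exact: mulr_gt0.
move=> M v; apply: le_trans (h1 _) _; rewrite -!mulrA ler_wpM2l ?(ltW c10)//.
apply: le_trans (mxnM _ _) _; rewrite mulrCA mulrC ler_wpM2l ?mxn_ge0//.
Qed.

Lemma opnorm_upper M : ubound [set nv (v *m M) | v in [set v | nv v <= 1]]%classic (opnorm nv M).
Proof.
have [c c0 hc] := opnorm_has_ub; apply: sup_upper_bound; split.
  by exists (nv (0 *m M)), 0 => //=; rewrite vnorm0.
exists (c * mxn M) => _ [v /= v1 <-]; apply: le_trans (hc _ _) _.
by rewrite ler_piMr// mulr_ge0 ?mxn_ge0// ltW.
Qed.

Lemma opnorm_ge0 M : 0 <= opnorm nv M.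
Proof.
have : nv (0 *m M) <= opnorm nv M by apply: opnorm_upper; exists 0 => //=; rewrite vnorm0.
by rewrite mul0mx vnorm0.
Qed.

Lemma opnorm_le M c : (forall v, nv v <= 1 -> nv (v *m M) <= c) -> opnorm nv M <= c.
Proof.
move=> h; apply: ge_sup; first by exists (nv (0 *m M)), 0 => //=; rewrite vnorm0.
by move=> _ [v /= v1 <-]; exact: h.
Qed.

Lemma opnormP M v : nv (v *m M) <= opnorm nv M * nv v.
Proof.
have [->|v0] := eqVneq v 0; first by rewrite mul0mx vnorm0// mulr0.
have nv0 : 0 < nv v.
  by rewrite lt_def vnorm_ge0// andbT; apply: contra_neq v0 => /vnorm_eq0 ->.
have : nv ((RC (nv v)^-1 *: v) *m M) <= opnorm nv M.
  apply: opnorm_upper; exists (RC (nv v)^-1 *: v) => //=.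
  by rewrite vnormZ// cabs_real ger0_norm ?invr_ge0 ?vnorm_ge0// mulVf// gt_eqF.
rewrite -scalemxAl vnormZ// cabs_real ger0_norm ?invr_ge0 ?vnorm_ge0//.
by rewrite ler_pdivrMl// mulrC.
Qed.

Let bA : R := 1 + \sum_(r < q) mxn (A r).

Let bA_ge1 : 1 <= bA.
Proof. by rewrite lerDl sumr_ge0// => r _; exact: mxn_ge0. Qed.

Let mxn_A r : (r < q)%N -> mxn (A r) <= bA.
Proof.
move=> rq; rewrite /bA (bigD1 (Ordinal rq))//= addrCA lerDl addr_ge0// sumr_ge0// => *.
exact: mxn_ge0.
Qed.

Lemma natprodw_crude n s : (forall i, (s i < q)%N) ->
  mxn (natprodw n s) <= mxn (1%:M : 'M[R[i]]_d) * bA ^+ n.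
Proof.
move=> sq; elim: n => [|n IHn]; first by rewrite natprodw0 expr0 mulr1.
rewrite -addn1 natprodwD natprodw1; apply: le_trans (mxnM _ _) _.
by rewrite exprD mulrA expr1 ler_pM ?mxn_ge0// mxn_A.
Qed.

Let ordfun n (s : nat -> nat) (i : 'I_n) : 'I_q := Ordinal (ltn_pmod (s i) (ltnW q2)).

Let ordfunE n s : (forall i, (s i < q)%N) ->
  prodw A (fun i => nat_of_ord (@ordfun n s i)) = natprodw n s.
Proof. by move=> sq; apply: eq_bigr => i _; rewrite /= modn_small. Qed.

(** [jsr_l] is a [sup], which bounds its set only if that set is bounded above; the crude bound
    provides this. *)
Lemma jsr_l_upper n s : (forall i, (s i < q)%N) ->
  opnorm nv (natprodw n s) `^ (n%:R^-1) <= jsr_l q nv A n.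
Proof.
move=> sq; apply: sup_upper_bound; last by exists (@ordfun n s); rewrite ordfunE.
have [c c0 hc] := opnorm_has_ub; split; first by eexists; exists (@ordfun n s).
exists ((c * (mxn (1%:M : 'M[R[i]]_d) * bA ^+ n)) `^ (n%:R^-1)) => _ [t ->].
have bAn : 0 <= bA ^+ n by rewrite exprn_ge0// (le_trans _ bA_ge1).
apply: ge0_ler_powR; rewrite ?invr_ge0 ?nnegrE ?opnorm_ge0//.
  by rewrite !mulr_ge0 ?mxn_ge0// ltW.
apply: opnorm_le => v v1; apply: le_trans (hc _ _) _.
apply: (@le_trans _ _ (c * mxn (prodw A (fun i => nat_of_ord (t i))))).
  by rewrite ler_piMr// mulr_ge0 ?mxn_ge0// ltW.
rewrite ler_wpM2l ?(ltW c0)//.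
pose t' k := if insub k is Some i then nat_of_ord (t i) else 0%N.
have -> : prodw A (fun i => nat_of_ord (t i)) = natprodw n t'.
  by apply: eq_bigr => i _; rewrite /t' valK.
apply: natprodw_crude => i; rewrite /t'; case: insubP => [j _ _|_] //.
exact: ltnW.
Qed.

Variable Rb : R.
Hypothesis RbP : (finiteness q nv A /\ Rb = jsr q nv A) \/ jsr q nv A < Rb.

(** This is where the choice of R is used: under the finiteness property R equals [jsr_l] at some l;
    otherwise R exceeds the infimum of the [jsr_l], hence one of them. *)
Lemma jsr_power : exists l : nat, [/\ (0 < l)%N, 0 <= Rb &
  forall s, (forall i, (s i < q)%N) -> opnorm nv (natprodw l s) <= Rb ^+ l].
Proof.
have [l l0 hl] : exists2 l, (0 < l)%N & jsr_l q nv A l <= Rb.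
  case: RbP => [[[l [l0 e]] ->]|h]; first by exists l => //; rewrite e.
  apply: contrapT => nl; move: h; rewrite ltNge => /negP; apply.
  apply: lb_le_inf; first by exists (jsr_l q nv A 1), 1%N.
  move=> _ [l /= l0 <-]; rewrite leNgt; apply/negP => h; apply: nl.
  by exists l => //; exact: ltW.
have Rb0 : 0 <= Rb.
  apply: le_trans hl; apply: le_trans (jsr_l_upper (s := fun=> 0%N) _ _).
    exact: powR_ge0.
  by move=> _; exact: ltnW.
exists l; split => // s sq.
have := le_trans (jsr_l_upper l sq) hl => h.
have -> : opnorm nv (natprodw l s) = (opnorm nv (natprodw l s) `^ (l%:R^-1)) ^+ l.
  rewrite -powR_mulrn ?powR_ge0// -powRrM mulVf ?powRr1 ?opnorm_ge0//.
  by rewrite pnatr_eq0 -lt0n.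
by apply: lerXn2r; rewrite ?nnegrE ?powR_ge0.
Qed.

Lemma Rb_ge0 : 0 <= Rb. Proof. by have [l []] := jsr_power. Qed.

Lemma natprodw_bound r : 0 < r -> Rb <= r -> exists2 c, 0 <= c &
  forall n s, (forall i, (s i < q)%N) -> mxn (natprodw n s) <= c * r ^+ n.
Proof.
move=> r0 Rbr; have [l [l0 Rb0 hl]] := jsr_power.
have [c1 c10 h1] := opnorm_has_ub; have [c2 c20 h2] := mxn_le_vnorm nvP.
have bA0 : 0 <= bA by exact: le_trans bA_ge1.
(* B pays for the incomplete block of length a < l: (1 + bA / r)^l dominates (bA / r)^a whether or
   not bA / r is below 1. *)
pose B := c1 * mxn (1%:M : 'M[R[i]]_d) * (1 + bA / r) ^+ l.
have B0 : 0 <= B.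
  rewrite !mulr_ge0 ?mxn_ge0 ?(ltW c10)// exprn_ge0// addr_ge0// divr_ge0//.
  exact: ltW.
have key k a s v : (a < l)%N -> (forall i, (s i < q)%N) ->
    nv (v *m natprodw (l * k + a) s) <= B * r ^+ (l * k + a) * nv v.
  move=> al; elim: k s v => [|k IHk] s v sq.
    rewrite muln0 add0n; apply: le_trans (h1 _ _) _; rewrite ler_wpM2r ?vnorm_ge0//.
    rewrite /B -mulrA -mulrA ler_wpM2l ?(ltW c10)//.
    apply: le_trans (natprodw_crude a sq) _; rewrite ler_wpM2l ?mxn_ge0//.
    have -> : bA ^+ a = (bA / r) ^+ a * r ^+ a.
      by rewrite -exprMn divfK// gt_eqF.
    rewrite ler_wpM2r ?exprn_ge0 ?(ltW r0)//.
    have bar : 0 <= bA / r by rewrite divr_ge0// ltW.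
    apply: (@le_trans _ _ ((1 + bA / r) ^+ a)).
      by apply: lerXn2r; rewrite ?nnegrE ?addr_ge0// lerDr.
    by apply: ler_weXn2l; [rewrite lerDl|exact: ltnW].
  (* One block of length l is split off on the left, at the price R^l <= r^l. *)
  rewrite mulnS -addnA natprodwD mulmxA.
  apply: le_trans (IHk _ _ _) _ => //; rewrite [in leRHS]exprD.
  have -> : B * (r ^+ l * r ^+ (l * k + a)) * nv v =
    B * r ^+ (l * k + a) * (r ^+ l * nv v) by ring.
  apply: ler_wpM2l; first by rewrite mulr_ge0 ?exprn_ge0 ?(ltW r0).
  apply: le_trans (opnormP _ _) _; rewrite ler_wpM2r ?vnorm_ge0//.
  by apply: le_trans (hl _ sq) _; apply: lerXn2r; rewrite ?nnegrE// ltW.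
(* Entries are recovered by applying the product to the unit row vectors. *)
clearbody B; exists (\sum_i (c2 * (B * nv (delta_mx 0 i)))).
  apply: sumr_ge0 => i _; apply: mulr_ge0; first exact: ltW.
  by apply: mulr_ge0 => //; exact: vnorm_ge0.
move=> n s sq; rewrite mulr_suml {1}/mxn ler_sum// => i _.
have -> : \sum_j cabs (natprodw n s i j) = mxn ((delta_mx 0 i : 'rV_d) *m natprodw n s).
  by rewrite -rowE /mxn big_ord1; apply: eq_bigr => j _; rewrite mxE.
apply: le_trans (h2 _) _; rewrite -!mulrA ler_wpM2l ?(ltW c20)//.
have nl : (n %% l < l)%N by rewrite ltn_mod.
have := key (n %/ l)%N (n %% l)%N s (delta_mx 0 i) nl sq; rewrite mulnC -divn_eq => h.
by apply: le_trans h _; rewrite -mulrA [r ^+ n * _]mulrC.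
Qed.

(** Substitute for [natprodw_bound] with r = R when R = 0: a product of length l has norm at most
    0^l = 0. *)
Lemma natprodw_nilp : Rb = 0 -> exists l, forall n s, (l <= n)%N ->
  (forall i, (s i < q)%N) -> natprodw n s = 0.
Proof.
move=> Rb0; have [l [l0 _ hl]] := jsr_power; exists l => n s ln sq.
rewrite -(subnKC ln) natprodwD; suff -> : natprodw l s = 0 by rewrite mul0mx.
apply/row_matrixP => i; rewrite row0 rowE; apply: (vnorm_eq0 nvP); apply/le_anti.
rewrite vnorm_ge0// andbT; apply: le_trans (opnormP _ _) _.
have := hl s sq; rewrite Rb0 expr0n gtn_eqF//= => o0.
by rewrite mulr_le0_ge0 ?vnorm_ge0.
Qed.

(** C^n is the sum of all q^n products of length n; the right factor X makes the induction on n go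
    through. *)
Lemma Cmat_power_bound n c (X : 'M[R[i]]_d) :
  (forall s, (forall i, (s i < q)%N) -> mxn (natprodw n s *m X) <= c) ->
  mxn (Cmat q A ^+ n *m X) <= q%:R ^+ n * c.
Proof.
elim: n X => [|n IHn] X h.
  by rewrite !expr0 mul1r mul1mx -(mul1mx X) -(natprodw0 (fun=> 0%N)) h// => _; exact: ltnW.
rewrite exprSr -mulmxE -mulmxA {2}/Cmat mulmx_suml mulmx_sumr.
apply: le_trans (mxn_sum _ _ _) _.
have -> : q%:R ^+ n.+1 * c = \sum_(r < q) (q%:R ^+ n * c).
  by rewrite sumr_const card_ord exprS -mulrA mulr_natl.
apply: ler_sum => r _.
apply: IHn => s sq; rewrite mulmxA.
have := h (fun i => if (i < n)%N then s i else r); rewrite -addn1 natprodwD natprodw1.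
rewrite addn0 ltnn (natprodw_ext (t := s)); first by apply => i; case: ifP.
by move=> i ->.
Qed.

(** Applying C^n to the eigenvector bounds |lam|^n by a constant times (q r)^n for every n; a ratio
    |lam| / (q r) above 1 would have unbounded powers. *)
Lemma eigenvalue_jsr_bound r lam (v : 'rV[R[i]]_d) : 0 < r -> Rb <= r ->
  v *m Cmat q A = lam *: v -> v != 0 -> cabs lam <= q%:R * r.
Proof.
move=> r0 Rbr vC v0; have [c c0 hc] := natprodw_bound r0 Rbr.
have vCn n : v *m Cmat q A ^+ n = lam ^+ n *: v.
  elim: n => [|n IHn]; first by rewrite !expr0 mulmx1 scale1r.
  by rewrite exprSr -mulmxE mulmxA IHn -scalemxAl vC scalerA exprSr.
have nv0 : 0 < mxn v by rewrite ltNge; apply: contraNN v0 => /mxn_eq0 ->.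
have bnd n : cabs lam ^+ n <= (q%:R * r) ^+ n * c.
  rewrite -(ler_pM2r nv0) -cabsX -mxnZ -vCn; apply: le_trans (mxnM _ _) _.
  rewrite mulrC ler_wpM2r ?mxn_ge0//.
  have /Cmat_power_bound : forall s, (forall i, (s i < q)%N) ->
      mxn (natprodw n s *m 1%:M) <= c * r ^+ n by move=> s sq; rewrite mulmx1; exact: hc.
  by rewrite mulmx1 exprMn -mulrA [c * _]mulrC.
rewrite leNgt; apply/negP => h.
have qr0 : 0 < q%:R * r by rewrite mulr_gt0// ltr0n ltnW.
have /geometric_unbounded : 1 < cabs lam / (q%:R * r) by rewrite ltr_pdivlMr// mul1r.
move=> /(_ c)[n]; rewrite ltNge => /negP; apply.
by rewrite expr_div_n ler_pdivrMr ?exprn_gt0// mulrC.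
Qed.

Lemma fseq_natprodw n : fseq q A n = natprodw (ndigits q n) (digit q n).
Proof. by []. Qed.

Lemma fseq_bound r : 0 < r -> Rb <= r -> exists2 c, 0 <= c &
  forall N, (0 < N)%N -> mxn (fseq q A N) <= c * r ^+ trunc_log q N.
Proof.
move=> r0 Rbr; have [c c0 hc] := natprodw_bound r0 Rbr.
(* A positive N has [trunc_log q N] + 1 digits, which costs one factor r. *)
exists (c * r); first by rewrite mulr_ge0// ltW.
move=> N N0; rewrite fseq_natprodw ndigitsE// -mulrA -exprS.
by apply: hc => i; rewrite ltn_mod ltnW.
Qed.

Lemma fseq_nilp : Rb = 0 -> exists l, forall N, (0 < N)%N -> (l <= trunc_log q N)%N ->
  fseq q A N = 0.
Proof.
move=> /natprodw_nilp[l hl]; exists l => N N0 lN; rewrite fseq_natprodw hl//.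
  by rewrite ndigitsE// leqW.
by move=> i; rewrite ltn_mod ltnW.
Qed.

End JointSpectralRadius.

(** * Limits and Holder continuity *)

Section GeometricLimits.
Local Open Scope classical_set_scope.
Local Open Scope ring_scope.
Variable R : realType.

Lemma lim_geometric_bound (u : nat -> R) (c th : R) : 0 <= c -> 0 <= th < 1 ->
  (forall n, `|u n.+1 - u n| <= c * th ^+ n) ->
  forall n, `|u n - lim (u @ \oo)| <= c / (1 - th) * th ^+ n.
Proof.
move=> c0 /andP[th0 th1] hu.
have th1' : 0 < 1 - th by rewrite subr_gt0.
pose K := c / (1 - th).
have K0 : 0 <= K by rewrite divr_ge0// ltW.
have cK : c = K * (1 - th) by rewrite divfK// gt_eqF.
have thn n : 0 <= th ^+ n by rewrite exprn_ge0.
have step n k : `|u (n + k)%N - u n| <= K * th ^+ n - K * th ^+ (n + k).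
  elim: k => [|k IHk]; first by rewrite addn0 !subrr normr0.
  have -> : u (n + k.+1)%N - u n = (u (n + k).+1 - u (n + k)%N) + (u (n + k)%N - u n).
    by rewrite addnS addrA subrK.
  apply: le_trans (ler_normD _ _) _; apply: le_trans (lerD (hu _) IHk) _.
  by rewrite cK addnS exprS le_eqVlt; apply/orP; left; apply/eqP; ring.
(* The intervals with centre u n and radius K th^n are nested, because c = K (1 - th); [l] is the
   supremum of their lower ends and lies in all of them. *)
pose l := sup (range (fun n => u n - K * th ^+ n)).
have ub n : u n - K * th ^+ n <= l /\ l <= u n + K * th ^+ n.
  have hub : has_ubound (range (fun n => u n - K * th ^+ n)).
    exists (u 0%N + K) => _ [k _ <-]; have := step 0%N k.
    rewrite add0n expr0 mulr1 ler_norml => /andP[_].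
    by have := mulr_ge0 K0 (thn k); lra.
  split; first by apply: ub_le_sup => //; exists n.
  apply: ge_sup; first by exists (u 0%N - K * th ^+ 0), 0%N.
  move=> _ [k _ <-]; have [nk|kn] := leqP n k.
    have := step n (k - n)%N; rewrite subnKC// ler_norml => /andP[_].
    by have := mulr_ge0 K0 (thn k); have := mulr_ge0 K0 (thn n); lra.
  have := step k (n - k)%N; rewrite subnKC ?(ltnW kn)// ler_norml => /andP[+ _].
  by have := mulr_ge0 K0 (thn k); have := mulr_ge0 K0 (thn n); lra.
have bnd n : `|u n - l| <= K * th ^+ n.
  by have [h1 h2] := ub n; rewrite ler_norml; apply/andP; split; lra.
have cvu : u @ \oo --> l.
  have cvK : (fun n => K * th ^+ n) @ \oo --> (0 : R).
    by apply: cvg_geometric; rewrite ger0_norm.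
  apply: (@squeeze_cvgr _ _ _ _ (fun n => l - K * th ^+ n) (fun n => l + K * th ^+ n)).
  - apply: nearW => n; have := bnd n; rewrite ler_norml => /andP[h1 h2].
    by apply/andP; split; lra.
  - by rewrite -[X in _ --> X]subr0; apply: cvgB => //; exact: cvg_cst.
  - by rewrite -[X in _ --> X]addr0; apply: cvgD => //; exact: cvg_cst.
by move=> n; rewrite (cvg_lim _ cvu).
Qed.

(** Identities involving limits are proved through it: the norm of the difference of both sides is
    at most c th^n for all n >= k. *)
Lemma geometric_le0 (x c th : R) k : 0 <= th < 1 ->
  (forall n, (k <= n)%N -> x <= c * th ^+ n) -> x <= 0.
Proof.
move=> /andP[th0 th1] h; rewrite leNgt; apply/negP => x0.
have [th00|th00] := eqVneq th 0.
  by have := h k.+1 (leqnSn _); rewrite th00 expr0n mulr0 leNgt x0.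
have thp : 0 < th by rewrite lt_def th00.
have [n hn] := geometric_unbounded (c / x) (x := th^-1) ltac:(by rewrite invf_gt1).
have := h (k + n)%N (leq_addr _ _); rewrite leNgt => /negP; apply.
have c0 : 0 < c.
  have := lt_le_trans x0 (h k (leqnn _)); rewrite pmulr_lgt0// exprn_gt0//.
move: hn; rewrite exprVn ltr_pdivrMr// ltr_pdivlMl ?exprn_gt0// => hn.
apply: le_lt_trans hn; rewrite mulrC ler_wpM2r ?(ltW c0)// exprD ler_piMl//.
  by rewrite exprn_ge0.
by rewrite exprn_ile1// ltW.
Qed.

Let ReB (x y : R[i]) : complex.Re (x - y) = complex.Re x - complex.Re y.
Proof. by case: x y => ? ? []. Qed.

Let ImB (x y : R[i]) : complex.Im (x - y) = complex.Im x - complex.Im y.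
Proof. by case: x y => ? ? []. Qed.

Definition mxlim p n (U : nat -> 'M[R[i]]_(p, n)) : 'M[R[i]]_(p, n) :=
  \matrix_(a, b) Complex (lim ((fun k => complex.Re (U k a b)) @ \oo))
                         (lim ((fun k => complex.Im (U k a b)) @ \oo)).

(** K depends on the shape only, so the rate is uniform in the parameter t of the sequences to which
    it is applied. *)
Lemma mxlim_bound p n : exists2 K, 0 <= K & forall (U : nat -> 'M[R[i]]_(p, n)) c th,
  0 <= c -> 0 <= th < 1 ->
  (forall k, mxn (U k.+1 - U k) <= c * th ^+ k) ->
  forall k, mxn (U k - mxlim U) <= K * (c / (1 - th)) * th ^+ k.
Proof.
exists (\sum_(a < p) \sum_(b < n) 2) => [|U c th c0 th01 hU k].
  by do 2!apply: sumr_ge0 => ? _.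
rewrite /mxn -mulrA mulr_suml ler_sum// => a _; rewrite mulr_suml ler_sum// => b _.
apply: le_trans (cabs_le_ReIm _) _; rewrite mulr_natl mulr2n; apply: lerD.
  rewrite !mxE ReB /=; apply: lim_geometric_bound => // m.
  apply: le_trans (hU m); apply: le_trans (mxn_entry _ a b).
  by rewrite !mxE -ReB Re_le_cabs.
rewrite !mxE ImB /=; apply: lim_geometric_bound => // m.
apply: le_trans (hU m); apply: le_trans (mxn_entry _ a b).
by rewrite !mxE -ImB Im_le_cabs.
Qed.

End GeometricLimits.

Section Holder.
Variables (R : realType) (al : R).
Hypothesis al01 : 0 < al <= 1.

Let al0 : 0 < al. Proof. by case/andP: al01. Qed.

(** The interval [0, 2] holds two periods, so that points on either side of an integer can be
    compared directly. *)
Definition holder p n (f : R -> 'M[R[i]]_(p, n)) : Prop :=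
  exists2 L, 0 <= L & forall x y, 0 <= x <= 2 -> 0 <= y <= 2 ->
    mxn (f x - f y) <= L * `|x - y| `^ al.

Lemma dist_le_powR x y : 0 <= x <= 2 -> 0 <= y <= 2 -> `|x - y| <= 2 * `|x - y| `^ al.
Proof.
move=> /andP[x0 x2] /andP[y0 y2].
have [->|xy] := eqVneq x y; first by rewrite subrr normr0 mulr_ge0// powR_ge0.
have d0 : 0 < `|x - y| by rewrite normr_gt0 subr_eq0.
have d2 : `|x - y| <= 2 by rewrite ler_norml; apply/andP; split; lra.
(* Halving brings the distance into (0, 1], where s <= s^al. *)
have h1 : `|x - y| / 2 <= (`|x - y| / 2) `^ al.
  apply: ger1_powR; last by case/andP: al01.
  by rewrite divr_gt0//= ler_pdivrMr// mul1r.
have h2 : (`|x - y| / 2) `^ al <= `|x - y| `^ al.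
  apply: ge0_ler_powR; rewrite ?nnegrE ?(ltW al0) ?divr_ge0//; lra.
lra.
Qed.

Lemma lipschitz_holder p n (f : R -> 'M[R[i]]_(p, n)) L : 0 <= L ->
  (forall x y, 0 <= x <= 2 -> 0 <= y <= 2 -> mxn (f x - f y) <= L * `|x - y|) ->
  holder f.
Proof.
move=> L0 h; exists (L * 2) => [|x y hx hy]; first by rewrite mulr_ge0.
by apply: le_trans (h x y hx hy) _; rewrite -mulrA ler_wpM2l// dist_le_powR.
Qed.

Lemma holder_cst p n (M : 'M[R[i]]_(p, n)) : holder (fun=> M).
Proof. by exists 0 => // x y _ _; rewrite subrr mxn0 mul0r. Qed.

Lemma holder_bounded p n (f : R -> 'M[R[i]]_(p, n)) : holder f ->
  exists2 B, 0 <= B & forall x, 0 <= x <= 2 -> mxn (f x) <= B.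
Proof.
move=> [L L0 h]; exists (mxn (f 0) + L * 2 `^ al).
  by rewrite addr_ge0 ?mxn_ge0// mulr_ge0// powR_ge0.
move=> x x02; rewrite -[f x](subrK (f 0)) addrC; apply: le_trans (mxnD _ _) _.
have h0 : 0 <= (0 : R) <= 2 by rewrite lexx /=.
rewrite lerD2l; apply: le_trans (h x 0 x02 h0) _; rewrite ler_wpM2l//.
by apply: ge0_ler_powR; rewrite ?nnegrE ?(ltW al0)// subr0; case/andP: x02 => ? ?; rewrite ger0_norm.
Qed.

Lemma holderD p n (f g : R -> 'M[R[i]]_(p, n)) : holder f -> holder g ->
  holder (fun x => f x + g x).
Proof.
move=> [L L0 hf] [M M0 hg]; exists (L + M) => [|x y hx hy]; first exact: addr_ge0.
rewrite opprD addrACA mulrDl; apply: le_trans (mxnD _ _) _.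
by apply: lerD; [exact: hf|exact: hg].
Qed.

Lemma holder_sum p n (I : Type) (r : seq I) (f : I -> R -> 'M[R[i]]_(p, n)) :
  (forall i, holder (f i)) -> holder (fun x => \sum_(i <- r) f i x).
Proof.
move=> hf; elim: r => [|i r IHr].
  by exists 0 => // x y _ _; rewrite !big_nil subrr mxn0 mul0r.
have [L L0 h] := holderD (hf i) IHr.
by exists L => // x y hx hy; rewrite !big_cons; exact: h.
Qed.

Lemma holder_bilinear p n p' n' p'' n''
    (B : 'M[R[i]]_(p, n) -> 'M[R[i]]_(p', n') -> 'M[R[i]]_(p'', n'')) f g :
  (forall a b c, B (a - b) c = B a c - B b c) ->
  (forall a b c, B a (b - c) = B a b - B a c) ->
  (forall a b, mxn (B a b) <= mxn a * mxn b) ->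
  holder f -> holder g -> holder (fun x => B (f x) (g x)).
Proof.
move=> Bl Br Bn hf hg; have [F F0 fF] := holder_bounded hf.
have [G G0 gG] := holder_bounded hg.
have [L L0 {}hf] := hf; have [M M0 {}hg] := hg.
exists (L * G + F * M) => [|x y hx hy]; first by rewrite addr_ge0// mulr_ge0.
have -> : B (f x) (g x) - B (f y) (g y) =
    B (f x - f y) (g x) + B (f y) (g x - g y) by rewrite Bl Br addrA subrK.
apply: le_trans (mxnD _ _) _; rewrite mulrDl; apply: lerD.
  apply: le_trans (Bn _ _) _; rewrite mulrAC.
  by apply: ler_pM; rewrite ?mxn_ge0//; [exact: hf|exact: gG].
apply: le_trans (Bn _ _) _; rewrite -mulrA.
by apply: ler_pM; rewrite ?mxn_ge0//; [exact: fF|exact: hg].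
Qed.

Lemma holderM p n k (f : R -> 'M[R[i]]_(p, n)) (g : R -> 'M[R[i]]_(n, k)) :
  holder f -> holder g -> holder (fun x => f x *m g x).
Proof.
apply: holder_bilinear => [a b c|a b c|a b].
- exact: mulmxBl.
- exact: mulmxBr.
- exact: mxnM.
Qed.

(** A scalar is treated as a 1 by 1 matrix and inherits the closure properties of [holder]. *)
Definition cholder (f : R -> R[i]) := holder (fun x => (f x)%:M : 'M[R[i]]_1).

Lemma mxn1 (a : R[i]) : mxn (a%:M : 'M[R[i]]_1) = cabs a.
Proof. by rewrite /mxn !big_ord1 !mxE eqxx mulr1n. Qed.

Lemma holderZ p n (a : R -> R[i]) (f : R -> 'M[R[i]]_(p, n)) :
  cholder a -> holder f -> holder (fun x => a x *: f x).
Proof.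
move=> ha hf; have [L L0 h] : holder (fun x => ((a x)%:M : 'M[R[i]]_1) 0 0 *: f x).
  apply: (holder_bilinear (B := fun (a : 'M[R[i]]_1) (M : 'M[R[i]]_(p, n)) => a 0 0 *: M)) => //.
  - by move=> u v c; rewrite !mxE scalerBl.
  - by move=> u v c; rewrite scalerBr.
  - by move=> u v; rewrite mxnZ ler_wpM2r ?mxn_ge0// mxn_entry.
by exists L => // x y hx hy; have := h x y hx hy; rewrite !mxE eqxx !mulr1n.
Qed.

Lemma cholderM f g : cholder f -> cholder g -> cholder (fun x => f x * g x).
Proof.
move=> hf hg; have [L L0 h] := holderM hf hg; exists L => // x y hx hy.
by rewrite !scalar_mxM; exact: h.
Qed.

Lemma cholderD f g : cholder f -> cholder g -> cholder (fun x => f x + g x).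
Proof.
move=> hf hg; have [L L0 h] := holderD hf hg; exists L => // x y hx hy.
by rewrite !(raddfD (@scalar_mx _ 1)); exact: h.
Qed.

Lemma lipschitz_cholder (f : R -> R[i]) L : 0 <= L ->
  (forall x y, 0 <= x <= 2 -> 0 <= y <= 2 -> cabs (f x - f y) <= L * `|x - y|) ->
  cholder f.
Proof.
move=> L0 h; apply: (lipschitz_holder L0) => x y hx hy.
by rewrite -raddfB mxn1; exact: h.
Qed.

Lemma cholder_horner (p : {poly R[i]}) (f : R -> R[i]) :
  cholder f -> cholder (fun x => p.[f x]).
Proof.
move=> hf; elim/poly_ind: p => [|p c IHp].
  by exists 0 => // x y _ _; rewrite !horner0 subrr mxn0 mul0r.
have [L L0 h] := cholderD (cholderM IHp hf) (holder_cst c%:M).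
by exists L => // x y hx hy; rewrite !hornerE; exact: h.
Qed.

End Holder.

(** * Complex exponential and principal logarithm *)

Section ComplexPowers.
Variable R : realType.
Implicit Types (z a : R[i]) (t : R).

Lemma cexpE (x y : R) : cexp (Complex x y) = Complex (expR x * cos y) (expR x * sin y).
Proof. by rewrite /cexp /=; simpc. Qed.

Lemma cexp0 : cexp (0 : R[i]) = 1.
Proof. by rewrite cexpE expR0 cos0 sin0 mulr1 mulr0. Qed.

Lemma cexp_RC t : cexp (RC t) = RC (expR t).
Proof. by rewrite (_ : RC t = Complex t 0)// cexpE cos0 sin0 mulr1 mulr0. Qed.

Lemma cexpD z a : cexp (z + a) = cexp z * cexp a.
Proof.
case: z a => [x y] [x' y']; have -> : Complex x y + Complex x' y' = Complex (x + x') (y + y') by simpc.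
rewrite !cexpE; simpc; rewrite expRD cosD sinD.
by congr Complex; ring.
Qed.

Lemma cabs_cexp z : cabs (cexp z) = expR (complex.Re z).
Proof.
case: z => x y; rewrite cexpE /cabs /= !exprMn -mulrDr cos2Dsin2 mulr1.
by rewrite sqrtr_sqr ger0_norm// expR_ge0.
Qed.

Lemma cexp_cLog z : z != 0 -> cexp (cLog z) = z.
Proof.
move=> z0; have az : 0 < cabs z by rewrite cabs_gt0.
rewrite /cLog cexpE lnK ?posrE// /carg.
set x := (complex.Re z / cabs z).
have x1 : -1 <= x <= 1.
  by rewrite -ler_norml normrM normfV (gtr0_norm az) ler_pdivrMr// mul1r Re_le_cabs.
have cx : cabs z * x = complex.Re z by rewrite mulrC divfK// gt_eqF.
have sx : cabs z * Num.sqrt (1 - x ^+ 2) = `|complex.Im z|.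
  rewrite -{1}(gtr0_norm az) -sqrtr_sqr -sqrtrM ?sqr_ge0// -sqrtr_sqr; congr Num.sqrt.
  rewrite mulrBr mulr1 -exprMn cx /cabs; case: z {z0 az x x1 cx} => a b /=.
  by rewrite sqr_sqrtr ?addr_ge0 ?sqr_ge0// addrC addKr.
have cosx : cos (acos x) = x by apply: acosK; rewrite in_itv.
case: ifPn => [i0|]; last rewrite -ltNge => i0.
  by rewrite cosx sin_acos// cx sx ger0_norm//; case: (z).
by rewrite cosN sinN cosx sin_acos// mulrN cx sx ltr0_norm// opprK; case: (z).
Qed.

Lemma cLog_pos t : 0 < t -> cLog (RC t) = RC (ln t).
Proof.
move=> t0; have ct : cabs (RC t) = t by rewrite cabs_real gtr0_norm.
by rewrite /cLog /carg ct /= lexx divff ?gt_eqF// acos1.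
Qed.

Lemma cLog1 : cLog (1 : R[i]) = 0.
Proof. by rewrite -[1]/(RC 1) cLog_pos// ln1. Qed.

Lemma cabs_cexp_cLog t z : z != 0 -> cabs (cexp (RC t * cLog z)) = cabs z `^ t.
Proof.
move=> z0; rewrite cabs_cexp powR_ln ?cabs_gt0//; congr expR.
by rewrite /RC /cLog /=; simpc.
Qed.

Lemma RCM (x y : R) : RC (x * y) = RC x * RC y.
Proof. by rewrite /RC; simpc. Qed.

Lemma RCD (x y : R) : RC (x + y) = RC x + RC y.
Proof. by rewrite /RC; simpc. Qed.

Lemma RCN (x : R) : RC (- x) = - RC x.
Proof. by rewrite /RC rmorphN. Qed.

Lemma RCX (x : R) n : RC (x ^+ n) = RC x ^+ n.
Proof. by elim: n => [|n IHn]; rewrite ?exprS ?RCM ?IHn. Qed.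

Lemma lipschitz_derive (f df : R -> R) :
  (forall x : R, is_derive x 1 f (df x)) -> (forall x, `|df x| <= 1) ->
  forall x y, `|f x - f y| <= `|x - y|.
Proof.
move=> fd d1 x y.
wlog xy : x y / x <= y.
  by move=> h; have [/h//|/ltW/h] := leP x y; rewrite distrC (distrC y).
have cf : continuous f by move=> z; apply/differentiable_continuous/derivable1_diffP.
have [c _ e] : exists2 c, c \in `[x, y]%R & f y - f x = df c * (y - x).
  by apply: MVT_segment => //; exact: continuous_subspaceT.
by rewrite distrC e normrM (distrC x) ler_piMl.
Qed.

Lemma sin_cos_le1 (x : R) : `|sin x| <= 1 /\ `|cos x| <= 1.
Proof. by rewrite !ler_norml sin_geN1 sin_le1 cos_geN1 cos_le1. Qed.

Lemma cos_lipschitz (x y : R) : `|cos x - cos y| <= `|x - y|.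
Proof.
apply: (lipschitz_derive (df := fun x => - sin x)) => // z.
by rewrite normrN; have [] := sin_cos_le1 z.
Qed.

Lemma sin_lipschitz (x y : R) : `|sin x - sin y| <= `|x - y|.
Proof.
by apply: (lipschitz_derive (df := cos)) => // z; have [] := sin_cos_le1 z.
Qed.

Lemma expR_lipschitz (B x y : R) : x <= B -> y <= B ->
  `|expR x - expR y| <= expR B * `|x - y|.
Proof.
wlog xy : x y / x <= y.
  by move=> h; have [/h//|/ltW/h] := leP x y; rewrite distrC (distrC y); auto.
move=> _ yB; rewrite distrC (distrC x) !ger0_norm ?subr_ge0 ?ler_expR//.
apply: (@le_trans _ _ (expR y * (y - x))); last by rewrite ler_wpM2r ?subr_ge0 ?ler_expR.
have -> : expR x = expR y * expR (x - y) by rewrite -expRD addrC subrK.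
rewrite -{1}[expR y]mulr1 -mulrBr ler_wpM2l ?expR_ge0//.
by have := expR_ge1Dx (x - y); lra.
Qed.

Lemma cexp_cholder (al : R) z : 0 < al <= 1 -> cholder al (fun t => cexp (RC t * z)).
Proof.
move=> al01; case: z => a b.
have lin t : RC t * Complex a b = Complex (t * a) (t * b) by rewrite /RC; simpc.
have hRC f L : 0 <= L -> (forall x y, 0 <= x <= 2 -> 0 <= y <= 2 ->
    `|f x - f y| <= L * `|x - y|) -> cholder al (fun t => RC (f t)).
  move=> L0 h; apply: (lipschitz_cholder al01 L0) => x y hx hy.
  by rewrite -RCN -RCD cabs_real; exact: h.
have hlin (c x y : R) : `|x * c - y * c| = `|c| * `|x - y| by rewrite -mulrBl normrM mulrC.
have hexp : cholder al (fun t => RC (expR (t * a))).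
  apply: (hRC _ (expR (2 * `|a|) * `|a|)); first by rewrite mulr_ge0 ?expR_ge0.
  move=> x y /andP[x0 x2] /andP[y0 y2]; rewrite -mulrA -hlin.
  apply: expR_lipschitz; rewrite (le_trans (ler_norm _))// normrM ler_wpM2r//;
    by rewrite ger0_norm.
have hcos : cholder al (fun t => RC (cos (t * b))).
  by apply: (hRC _ `|b|) => // x y _ _; rewrite -hlin cos_lipschitz.
have hsin : cholder al (fun t => RC (sin (t * b))).
  by apply: (hRC _ `|b|) => // x y _ _; rewrite -hlin sin_lipschitz.
have hi : cholder al (fun=> Complex 0 1) by exact: holder_cst.
have [L L0 h] := cholderM al01 hexp (cholderD hcos (cholderM al01 hi hsin)).
have e t : RC (expR (t * a)) * (RC (cos (t * b)) + Complex 0 1 * RC (sin (t * b))) =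
    cexp (RC t * Complex a b).
  by rewrite lin cexpE /RC; simpc.
by exists L => // x y hx hy; rewrite -!e; exact: h.
Qed.

End ComplexPowers.

(** * Renormalisation *)

Section Renormalization.
Variables (R : realType) (q m d : nat).
Hypothesis q2 : (2 <= q)%N.
Variables (Lam : R -> 'M[R[i]]_m) (P : nat -> 'M[R[i]]_(m, d)).
Hypothesis Lam0 : Lam 0 = 1%:M.
Hypothesis LamD : forall s t, Lam (s + t) = Lam s *m Lam t.
Hypothesis PM : forall N, (0 < N)%N -> P (q * N) = Lam 1 *m P N.

Let q0 : (0 : R) < q%:R. Proof. by rewrite ltr0n ltnW. Qed.
Let q1 : (1 : R) < q%:R. Proof. by rewrite ltr1n. Qed.
Let lnq : 0 < ln (q%:R : R). Proof. exact: ln_gt0. Qed.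

Let powqD (a b : R) : q%:R `^ (a + b) = q%:R `^ a * q%:R `^ b.
Proof. by rewrite powRD// (gt_eqF q0) implybT. Qed.

Lemma powR_logq N : (0 < N)%N -> q%:R `^ logq q N%:R = N%:R :> R.
Proof.
move=> N0; rewrite powR_ln// /logq divfK ?gt_eqF// lnK// posrE.
by rewrite ltr0n.
Qed.

Definition scale_floor n (t : R) : nat := Num.truncn (q%:R `^ (n%:R + t)).

Lemma scale_floorS n t : scale_floor n (t + 1) = scale_floor n.+1 t.
Proof. by rewrite /scale_floor -natr1 -addrA [1 + t]addrC. Qed.

Lemma scale_floor_itv n t :
  (scale_floor n t)%:R <= (q%:R : R) `^ (n%:R + t) < (scale_floor n t).+1%:R.
Proof. by apply: truncn_itv; exact: powR_ge0. Qed.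

(** Passing from scale n + 1 to scale n deletes the last digit, which is the situation of
    [Pstep]. *)
Lemma scale_floor_div n t : (scale_floor n.+1 t %/ q)%N = scale_floor n t.
Proof.
apply/esym/truncn_def; have /andP[lo hi] := scale_floor_itv n.+1 t.
have e : q%:R `^ (n.+1%:R + t) = q%:R * q%:R `^ (n%:R + t) :> R.
  by rewrite -natr1 addrAC powqD powRr1 ?(ltW q0)// mulrC.
apply/andP; split.
  rewrite -(ler_pM2l q0) -e; apply: le_trans lo; rewrite -natrM ler_nat mulnC.
  exact: leq_trunc_div.
rewrite -(ltr_pM2l q0) -e; apply: lt_le_trans hi _.
by rewrite -natrM ler_nat mulnC ltn_ceil// ltnW.
Qed.

Lemma scale_floor_gt0 n t : 0 <= t -> (0 < scale_floor n t)%N.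
Proof.
move=> t0; rewrite truncn_gt0 -[leLHS](powRr0 q%:R); apply: ler_powR; first exact: ltW.
by rewrite addr_ge0.
Qed.

Lemma trunc_log_scale n t : 0 <= t <= 2 ->
  (n <= trunc_log q (scale_floor n t) <= n.+2)%N.
Proof.
move=> /andP[t0 t2]; have s0 := scale_floor_gt0 n t0.
apply/andP; split.
  apply: trunc_log_max => //; rewrite truncn_ge_nat ?powR_ge0// natrX -powR_mulrn ?(ltW q0)//.
  by apply: ler_powR; rewrite ?lerDl// ltW.
have /andP[lo _] := scale_floor_itv n t.
have : (q ^ trunc_log q (scale_floor n t) <= q ^ n.+2)%N.
  apply: leq_trans (trunc_logP q2 s0) _; rewrite -(ler_nat R); apply: le_trans lo _.
  rewrite natrX -powR_mulrn ?(ltW q0)//; apply: ler_powR; first exact: ltW.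
  by rewrite -[in leRHS]addn2 natrD lerD2l.
by rewrite leq_exp2l.
Qed.

Definition renorm (t : R) (n : nat) := Lam (- n%:R) *m P (scale_floor n t).

Definition profile (t : R) := mxlim (renorm t).

Section Rate.
(** Per digit, the increments of P grow at rate r, and the negative powers of [Lam 1] decay at rate
    1/mu. In the application mu lies strictly below |lam|, to absorb the polynomial factor of the
    Jordan block. *)
Variables (r mu c1 c2 : R).
Hypotheses (r0 : 0 < r) (rmu : r < mu) (c10 : 0 <= c1) (c20 : 0 <= c2).
Hypothesis Pstep : forall N, (q <= N)%N ->
  mxn (P N - Lam 1 *m P (N %/ q)) <= c1 * r ^+ trunc_log q N.
Hypothesis Psucc : forall N, (0 < N)%N ->
  mxn (P N.+1 - P N) <= c1 * r ^+ trunc_log q N.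
Hypothesis LamN : forall n, mxn (Lam (- n%:R)) <= c2 * mu ^- n.

Let mu0 : 0 < mu. Proof. exact: lt_trans rmu. Qed.
Let th01 : 0 <= r / mu < 1.
Proof. by rewrite divr_ge0 ?ltW//= ltr_pdivrMr// mul1r. Qed.

Let C0 : 0 <= c2 * c1 * (1 + r) ^+ 2.
Proof. by rewrite mulr_ge0 ?(mulr_ge0 c20 c10)// exprn_ge0// addr_ge0// ltW. Qed.

(** The bound t <= 2 adds at most two to the exponent n; the base 1 + r >= 1 avoids distinguishing r
    < 1 from r >= 1. *)
Lemma rate_scale n t : 0 <= t <= 2 ->
  r ^+ trunc_log q (scale_floor n t) <= (1 + r) ^+ 2 * r ^+ n.
Proof.
move=> t02; have /andP[lo hi] := trunc_log_scale n t02.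
set k := trunc_log _ _ in lo hi *.
rewrite -(subnK lo) exprD ler_wpM2r ?exprn_ge0 ?(ltW r0)//.
apply: (@le_trans _ _ ((1 + r) ^+ (k - n))).
  by apply: lerXn2r; rewrite ?nnegrE ?addr_ge0 ?(ltW r0)// lerDr.
by apply: ler_weXn2l; rewrite ?lerDl ?(ltW r0)// leq_subLR addn2.
Qed.

Lemma Lam_rate n (M : 'M[R[i]]_(m, d)) : mxn M <= c1 * ((1 + r) ^+ 2 * r ^+ n) ->
  mxn (Lam (- n%:R) *m M) <= c2 * c1 * (1 + r) ^+ 2 * (r / mu) ^+ n.
Proof.
move=> h; apply: le_trans (mxnM _ _) _.
apply: (@le_trans _ _ ((c2 * mu ^- n) * (c1 * ((1 + r) ^+ 2 * r ^+ n)))).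
  by apply: ler_pM; rewrite ?mxn_ge0.
by rewrite expr_div_n le_eqVlt; apply/orP; left; apply/eqP; ring.
Qed.

Lemma renorm_step t n : 0 <= t <= 2 ->
  mxn (renorm t n.+1 - renorm t n) <= c2 * c1 * (1 + r) ^+ 2 * (r / mu) ^+ n.
Proof.
move=> t02; have t0 : 0 <= t by case/andP: t02.
have -> : renorm t n.+1 - renorm t n =
    Lam (- n.+1%:R) *m (P (scale_floor n.+1 t) - Lam 1 *m P (scale_floor n t)).
  rewrite mulmxBr mulmxA -LamD; congr (_ - Lam _ *m _).
  by rewrite -natr1 opprD addrNK.
have qs : (q <= scale_floor n.+1 t)%N.
  by have := scale_floor_gt0 n t0; rewrite -(scale_floor_div n t) divn_gt0 ?(ltnW q2).
set M := _ - _.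
have /Lam_rate hM : mxn M <= c1 * ((1 + r) ^+ 2 * r ^+ n.+1).
  rewrite /M -(scale_floor_div n t); apply: le_trans (Pstep qs) _.
  by rewrite ler_wpM2l// rate_scale.
apply: le_trans hM _.
rewrite [_ ^+ n.+1]exprS mulrCA ler_piMl ?mulr_ge0 ?exprn_ge0 ?addr_ge0 ?(ltW r0)//.
  by case/andP: th01.
by case/andP: th01 => _ /ltW.
Qed.

Lemma profile_rate : exists2 c, 0 <= c & forall t n, 0 <= t <= 2 ->
  mxn (renorm t n - profile t) <= c * (r / mu) ^+ n.
Proof.
have [K K0 hK] := mxlim_bound R m d.
exists (K * (c2 * c1 * (1 + r) ^+ 2 / (1 - r / mu))).
  by rewrite mulr_ge0// divr_ge0// subr_ge0 ltW//; case/andP: th01.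
by move=> t n t02; apply: hK => // k; exact: renorm_step.
Qed.

Lemma profileS t : 0 <= t <= 1 -> profile (t + 1) = Lam 1 *m profile t.
Proof.
move=> /andP[t0 t1]; have [c c0 hc] := profile_rate.
have h1 : 0 <= t <= 2 by apply/andP; split; lra.
have h2 : 0 <= t + 1 <= 2 by apply/andP; split; lra.
apply/subr0_eq/mxn_eq0; apply: (geometric_le0 (c := c + mxn (Lam 1) * c) (k := 0) th01).
move=> n _; have -> : profile (t + 1) - Lam 1 *m profile t =
    - (renorm (t + 1) n - profile (t + 1)) + Lam 1 *m (renorm t n.+1 - profile t).
  (* Raising t by 1 amounts to passing to the next scale. *)
  have -> : renorm (t + 1) n = Lam 1 *m renorm t n.+1.
    rewrite /renorm scale_floorS mulmxA -LamD; congr (Lam _ *m _).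
    by rewrite -natr1 opprD addrCA subrr addr0.
  by rewrite mulmxBr opprB addrA subrK.
apply: le_trans (mxnD _ _) _; rewrite mxnN mulrDl; apply: lerD; first exact: hc.
apply: le_trans (mxnM _ _) _; rewrite -mulrA ler_wpM2l ?mxn_ge0//.
apply: le_trans (hc t n.+1 h1) _; rewrite ler_wpM2l// exprS ler_piMl ?exprn_ge0//.
  by case/andP: th01.
by case/andP: th01 => _ /ltW.
Qed.

(** At t = log_q N - n the floors at the scales k >= n are the integers q^(k-n) N themselves, so the
    approximants are constant from k = n on and the limit carries no error. *)
Lemma profile_nat N : (0 < N)%N ->
  profile (logq q N%:R - (trunc_log q N)%:R) =
  Lam (- (trunc_log q N)%:R) *m P N.
Proof.
move=> N0; set n := trunc_log q N; set t := logq q N%:R.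
have Nt : q%:R `^ t = N%:R by exact: powR_logq.
have /andP[lo hi] := trunc_log_bounds q2 N0.
have qpos k : (q%:R : R) ^+ k \in Num.pos by rewrite posrE exprn_gt0.
have Npos : (N%:R : R) \in Num.pos by rewrite posrE ltr0n.
have tn0 : 0 <= t - n%:R.
  rewrite subr_ge0 /t /logq ler_pdivlMr// mulr_natl -lnXn// ler_ln//.
  by rewrite -natrX ler_nat.
have tn2 : t - n%:R <= 2.
  apply: (@le_trans _ _ 1); last by lra.
  rewrite lerBlDr addrC natr1 /t /logq ler_pdivrMr// mulr_natl -lnXn//.
  by rewrite ler_ln// -natrX ler_nat ltnW.
have [c c0 hc] := profile_rate.
apply/subr0_eq/mxn_eq0; apply: (geometric_le0 (c := c) (k := n) th01) => k nk.
suff <- : renorm (t - n%:R) k = Lam (- n%:R) *m P N.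
  by rewrite mxnC; apply: hc; rewrite tn0.
have PX j : P (q ^ j * N)%N = Lam j%:R *m P N.
  elim: j => [|j IHj]; first by rewrite mul1n Lam0 mul1mx.
  by rewrite expnS -mulnA PM ?muln_gt0 ?expn_gt0 ?N0 ?(ltnW q2)// IHj mulmxA -LamD -natr1 addrC.
rewrite /renorm; have -> : scale_floor k (t - n%:R) = (q ^ (k - n) * N)%N.
  rewrite /scale_floor addrCA -natrB// powqD Nt.
  by rewrite powR_mulrn ?(ltW q0)// -natrX -natrM natrK mulnC.
by rewrite PX mulmxA -LamD natrB//; congr (Lam _ *m _); ring.
Qed.

(* On the scale [q ^ - n] comparable to [|x - y|], the integer parts of
   [q ^ (n + x)] and [q ^ (n + y)] differ by at most one. *)
Lemma profile_holder al : 0 < al -> r / mu = q%:R `^ (- al) -> holder al profile.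
Proof.
move=> al0 ral; have [c c0 hc] := profile_rate.
have tele (a b x y : 'M[R[i]]_(m, d)) : a - b = (y - b) - (x - a) - (y - x).
  by apply/matrixP => i j; rewrite !mxE; ring.
have natrS k : (k.+1%:R : R) = k%:R + 1 by rewrite natr1.
(* A Lipschitz constant of q^x on [0, 2], where the derivative is at most q^2 ln q. *)
pose K : R := q%:R `^ 2 * ln q%:R + 1.
have K0 : 0 < K by rewrite ltr_wpDl// mulr_ge0 ?powR_ge0// ltW.
have lipq x y : 0 <= x -> x <= y -> y <= 2 -> q%:R `^ y - q%:R `^ x <= K * (y - x).
  move=> x0 xy y2; rewrite !powR_ln//; apply: le_trans (ler_norm _) _.
  have lnq0 := ltW lnq.
  apply: le_trans (expR_lipschitz (B := 2 * ln q%:R) _ _) _;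
    rewrite ?ler_wpM2r// ?(le_trans xy)//.
  rewrite -mulrBl normrM (ger0_norm lnq0) ger0_norm ?subr_ge0// [(y - x) * _]mulrC mulrA.
  by rewrite ler_wpM2r ?subr_ge0// /K powR_ln// lerDl.
(* Bounds all initial approximants, because floor(q^t) <= q^2. *)
pose B0 : R := mxn (Lam (- 0)) * \sum_(k < (q ^ 2).+1) mxn (P k).
have B00 : 0 <= B0.
  by rewrite mulr_ge0 ?mxn_ge0// sumr_ge0// => k _; exact: mxn_ge0.
have renorm0 t : 0 <= t <= 2 -> mxn (renorm t 0) <= B0.
  move=> /andP[t0 t2]; apply: le_trans (mxnM _ _) _; rewrite ler_wpM2l ?mxn_ge0//.
  have sq : (scale_floor 0 t < (q ^ 2).+1)%N.
    rewrite ltnS -(ler_nat R); have /andP[lo _] := scale_floor_itv 0 t.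
    apply: le_trans lo _; rewrite natrX -powR_mulrn ?(ltW q0)//.
    by apply: ler_powR; rewrite ?add0r// ltW.
  rewrite (bigD1 (Ordinal sq))//= lerDl sumr_ge0// => k _; exact: mxn_ge0.
pose D : R := 2 * (c + B0) + c2 * c1 * (1 + r) ^+ 2.
have D0 : 0 <= D.
  by rewrite addr_ge0 ?C0// mulr_ge0// addr_ge0.
have pw x y n : 0 <= x -> x <= y -> y <= 2 -> q%:R ^+ n * (K * (y - x)) <= 1 ->
    mxn (profile x - profile y) <= D * (r / mu) ^+ n.
  move=> x0 xy y2 hn.
  have hx : 0 <= x <= 2 by rewrite x0 (le_trans xy).
  have hy : 0 <= y <= 2 by rewrite y2 (le_trans x0).
  have thn : 0 <= (r / mu) ^+ n by rewrite exprn_ge0//; case/andP: th01.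
  have hd : mxn (renorm y n - renorm x n) <= c2 * c1 * (1 + r) ^+ 2 * (r / mu) ^+ n.
    rewrite -mulmxBr; apply: Lam_rate.
    have /andP[lox hix] := scale_floor_itv n x; have /andP[loy hiy] := scale_floor_itv n y.
    have s0 := scale_floor_gt0 n x0.
    have sxy : (scale_floor n x <= scale_floor n y)%N.
      by apply: le_truncn; apply: ler_powR; rewrite ?lerD2l// ltW.
    have syx : (scale_floor n y <= (scale_floor n x).+1)%N.
      rewrite truncn_le_nat; apply: (@le_lt_trans _ _ (q%:R `^ (n%:R + x) + 1)); last first.
        by rewrite (natrS (scale_floor n x).+1) ltrD2r; exact: hix.
      rewrite -lerBlDl !powqD -mulrBr powR_mulrn ?(ltW q0)//.
      by apply: le_trans hn; rewrite ler_wpM2l ?exprn_ge0 ?(ltW q0)// lipq.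
    have [e|ne] := eqVneq (scale_floor n y) (scale_floor n x).
      by rewrite e subrr mxn0 mulr_ge0// mulr_ge0 ?exprn_ge0 ?addr_ge0 ?(ltW r0).
    have -> : scale_floor n y = (scale_floor n x).+1.
      by apply/eqP; rewrite eqn_leq syx ltn_neqAle eq_sym ne sxy.
    by apply: le_trans (Psucc s0) _; rewrite ler_wpM2l// rate_scale.
  have -> : profile x - profile y = (renorm y n - profile y) -
      (renorm x n - profile x) - (renorm y n - renorm x n).
    exact: tele.
  apply: le_trans (mxnB _ _) _; apply: (@le_trans _ _ ((c + c) * (r / mu) ^+ n +
      c2 * c1 * (1 + r) ^+ 2 * (r / mu) ^+ n)).
    apply: lerD => //; apply: le_trans (mxnB _ _) _; rewrite mulrDl.
    by apply: lerD; exact: hc.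
  rewrite -mulrDl ler_wpM2r// /D lerD2r.
  by rewrite mulrDr mulr_natl mulr2n lerDl mulr_ge0.
have bnd x y : 0 <= x <= 2 -> 0 <= y <= 2 -> mxn (profile x - profile y) <= D.
  move=> hx hy.
  have pb t : 0 <= t <= 2 -> mxn (profile t) <= c + B0.
    move=> ht; rewrite -[profile t](subrK (renorm t 0)).
    apply: le_trans (mxnD _ _) _; apply: lerD; last exact: renorm0.
    by rewrite mxnC; have := hc t 0%N ht; rewrite expr0 mulr1.
  apply: le_trans (mxnB _ _) _; apply: le_trans (lerD (pb _ hx) (pb _ hy)) _.
  by rewrite /D mulr_natl mulr2n lerDl C0.
have main x y : 0 <= x -> x < y -> y <= 2 ->
    mxn (profile x - profile y) <= D * (q%:R * K) `^ al * `|x - y| `^ al.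
  move=> x0 xy y2; have hx : 0 <= x <= 2 by rewrite x0 (le_trans (ltW xy)).
  have hy : 0 <= y <= 2 by rewrite y2 (le_trans x0)// ltW.
  have yx0 : 0 < y - x by rewrite subr_gt0.
  have Kyx : 0 < K * (y - x) by rewrite mulr_gt0.
  rewrite distrC (gtr0_norm yx0) -mulrA -powRM ?mulr_ge0 ?(ltW q0) ?(ltW K0) ?(ltW yx0)//.
  rewrite -(mulrA q%:R).
  (* For points at distance at least 1/K, boundedness of the profile suffices. *)
  have [K1|K1] := leP 1 (K * (y - x)).
    apply: le_trans (bnd _ _ hx hy) _; rewrite ler_peMr//.
    rewrite -[leLHS](powRr0 (q%:R * (K * (y - x)))); apply: ler_powR; last exact: ltW.
    by rewrite -[leLHS]mulr1; apply: ler_pM => //; exact: ltW.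
  (* Below, n is the largest integer with q^n <= z. This inequality makes [pw] applicable, and z <=
     q^(n+1) bounds (r/mu)^n = q^(-al n) by (q K (y - x))^al. *)
  pose z := (K * (y - x))^-1.
  have z1 : 1 <= z by rewrite /z invf_ge1// ltW.
  have z0 : 0 <= z by exact: le_trans z1.
  have tz0 : (0 < Num.truncn z)%N by rewrite truncn_gt0.
  have /andP[lo hi] := trunc_log_bounds q2 tz0.
  have /andP[tlo thi] := truncn_itv z0.
  set n := trunc_log q (Num.truncn z) in lo hi.
  have qnz : q%:R ^+ n <= z by apply: le_trans tlo; rewrite -natrX ler_nat.
  have zqn : z <= q%:R ^+ n.+1.
    by apply: le_trans (ltW thi) _; rewrite -natrX ler_nat.
  apply: le_trans (pw x y n x0 (ltW xy) y2 _) _; first by rewrite -ler_pdivlMr// mul1r.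
  rewrite ler_wpM2l// ral -powR_mulrn ?powR_ge0// -powRrM mulNr mulrC -mulNr powRrM.
  apply: ge0_ler_powR; rewrite ?nnegrE ?powR_ge0 ?(ltW al0)//.
    by rewrite mulr_ge0 ?(ltW q0)// ltW.
  rewrite powR_invn ?(ltW q0)// -[leLHS]mul1r ler_pdivrMr ?exprn_gt0//.
  by rewrite mulrAC -exprS -ler_pdivrMr// mul1r.
exists (D * (q%:R * K) `^ al); first by rewrite mulr_ge0 ?powR_ge0.
move=> x y hx hy; have [xy|yx|->] := ltgtP x y.
- by apply: main => //; [case/andP: hx|case/andP: hy].
- by rewrite mxnC distrC; apply: main => //; [case/andP: hy|case/andP: hx].
by rewrite !subrr mxn0 mulr_ge0 ?powR_ge0// mulr_ge0 ?powR_ge0.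
Qed.

End Rate.

End Renormalization.

(** * Periodic extension by the fractional part *)

Section PeriodicExtension.
Variable R : realType.

Lemma fracpart_itv (u : R) : 0 <= fracpart u < 1.
Proof.
have /andP[h1 h2] := floor_itv u; rewrite /fracpart.
by rewrite intrD in h2; apply/andP; split; lra.
Qed.

Lemma fracpartDint (u : R) (z : int) : fracpart (u + z%:~R) = fracpart u.
Proof.
by rewrite /fracpart floorDrz ?intr_int// intrKfloor intrD; ring.
Qed.

Lemma fracpart_id (u : R) : 0 <= u < 1 -> fracpart u = u.
Proof. by move=> u01; rewrite /fracpart (@floor_def _ _ 0) ?subr0. Qed.

Variables (p n : nat) (f : R -> 'M[R[i]]_(p, n)) (al : R).
Hypothesis al01 : 0 < al <= 1.
Hypothesis fP : forall t, 0 <= t <= 1 -> f (t + 1) = f t.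

Lemma periodic_extension x k : 0 <= x - k%:~R < 2 ->
  f (fracpart x) = f (x - k%:~R).
Proof.
move=> /andP[h0 h2]; rewrite -[in fracpart x](subrK k%:~R x) fracpartDint.
have [h1|h1] := ltP (x - k%:~R) 1; first by rewrite fracpart_id// h0.
have -> : x - k%:~R = (x - k%:~R - 1) + 1%:~R by rewrite subrK.
rewrite fracpartDint fracpart_id ?fP//; apply/andP; split; lra.
Qed.

(** Points x <= y at distance less than 1 lie in the window [k, k + 2) with k = floor x, where the
    estimate on [0, 2] applies without wrapping around. For distant points f is bounded and |x -
    y|^al is at least 1. *)
Lemma periodic_holder : holder al f -> exists2 L, 0 <= L &
  forall x y, mxn (f (fracpart x) - f (fracpart y)) <= L * `|x - y| `^ al.
Proof.
move=> hf; have [B B0 hB] := holder_bounded al01 hf; have [L L0 {}hf] := hf.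
exists (L + (B + B)) => [|x y]; first by rewrite !addr_ge0.
have al0 : 0 < al by case/andP: al01.
wlog xy : x y / x <= y.
  by move=> h; have [/h//|/ltW/h] := leP x y; rewrite mxnC distrC.
have d0 : 0 <= y - x by rewrite subr_ge0.
rewrite distrC (ger0_norm d0) mulrDl.
have /andP[fx0 fx1] := fracpart_itv x; have /andP[fy0 fy1] := fracpart_itv y.
have [d1|d1] := leP 1 (y - x).
  apply: ler_wpDl; first by rewrite mulr_ge0// powR_ge0.
  apply: le_trans (mxnB _ _) _; apply: (@le_trans _ _ (B + B)).
    by apply: lerD; apply: hB; apply/andP; split; lra.
  rewrite ler_peMr ?addr_ge0// -[leLHS](powRr0 (y - x)).
  by apply: ler_powR; last exact: ltW.
apply: ler_wpDr; first by rewrite mulr_ge0 ?addr_ge0// powR_ge0.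
have hx : f (fracpart x) = f (x - (Num.floor x)%:~R) by [].
have hy : f (fracpart y) = f (y - (Num.floor x)%:~R).
  by apply: periodic_extension; rewrite /fracpart in fx0 fx1; apply/andP; split; lra.
rewrite hx hy -(ger0_norm d0) distrC; rewrite /fracpart in fx0 fx1.
have -> : x - y = (x - (Num.floor x)%:~R) - (y - (Num.floor x)%:~R) by lra.
by apply: hf; apply/andP; split; lra.
Qed.

End PeriodicExtension.

(** * Growth and Lipschitz bounds for binomial polynomials *)

Section BinomialBounds.
Variable R : realType.

Let cabsS k : cabs (k.+1%:R^-1 : R[i]) = k.+1%:R^-1.
Proof. by rewrite cabsV cabs_nat. Qed.

Let RCBn (t : R) k : RC t - k%:R = RC (t - k%:R).
Proof. by rewrite RCD RCN RC_nat. Qed.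

Let normBn (t : R) k : `|t - k%:R| <= k.+1%:R * (1 + `|t|).
Proof.
apply: le_trans (ler_normB _ _) _; rewrite normr_nat -natr1.
have : 0 <= k%:R * `|t| by rewrite mulr_ge0.
lra.
Qed.

Lemma binp_bound k (t : R) : cabs (binp _ k).[RC t] <= (1 + `|t|) ^+ k.
Proof.
elim: k => [|k IHk]; first by rewrite binp0 cabs1.
rewrite binpS !cabsM cabsS RCBn cabs_real ler_pdivrMr// exprSr -mulrA.
by apply: ler_pM; rewrite ?cabs_ge0// mulrC.
Qed.

Lemma binp_lipschitz k (s t T : R) : `|s| <= T -> `|t| <= T ->
  cabs ((binp _ k).[RC s] - (binp _ k).[RC t]) <= k%:R * (1 + T) ^+ k * `|s - t|.
Proof.
move=> sT tT; have T0 : 0 <= T by exact: le_trans sT.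
have T1 : 1 <= 1 + T by rewrite lerDl.
elim: k => [|k IHk]; first by rewrite !binp0 subrr cabs0 !mul0r.
have -> : (binp _ k.+1).[RC s] - (binp _ k.+1).[RC t] =
    (((binp _ k).[RC s] - (binp _ k).[RC t]) * (RC s - k%:R) +
     (binp _ k).[RC t] * RC (s - t)) / k.+1%:R.
  by rewrite !binpS RCD RCN; field; rewrite addrC natr1 pnatr_eq0.
rewrite cabsM cabsS ler_pdivrMr//; apply: le_trans (cabsD _ _) _.
rewrite !cabsM RCBn !cabs_real.
have h1 : `|s - k%:R| <= k.+1%:R * (1 + T).
  by apply: le_trans (normBn _ _) _; rewrite ler_wpM2l// lerD2l.
have h2 : cabs (binp _ k).[RC t] <= (1 + T) ^+ k.+1.
  apply: le_trans (binp_bound _ _) _; apply: (@le_trans _ _ ((1 + T) ^+ k)).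
    by apply: lerXn2r; rewrite ?nnegrE ?addr_ge0// lerD2l.
  by apply: ler_weXn2l.
apply: (@le_trans _ _ (k%:R * (1 + T) ^+ k * `|s - t| * (k.+1%:R * (1 + T)) +
   (1 + T) ^+ k.+1 * `|s - t|)).
  by apply: lerD; [apply: ler_pM; rewrite ?cabs_ge0|rewrite ler_wpM2r].
have e : (1 + T) ^+ k.+1 = (1 + T) ^+ k * (1 + T) by rewrite exprSr.
have p0 : 0 <= (1 + T) ^+ k.+1 * `|s - t|.
  by rewrite mulr_ge0// exprn_ge0// addr_ge0.
have : (1 + T) ^+ k.+1 * `|s - t| <= k.+1%:R * ((1 + T) ^+ k.+1 * `|s - t|).
  by rewrite ler_peMl// ler1n.
rewrite -[k.+1%:R in X in _ -> _ <= X * _ * _ * _]natr1 e; nra.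
Qed.

Lemma unipow_bound m (X : 'M[R[i]]_m.+1) : exists2 c, 0 <= c &
  forall t : R, mxn (unipow X (RC t)) <= c * (1 + `|t|) ^+ m.
Proof.
exists (\sum_(k < m.+1) mxn (X ^+ k)) => [|t].
  by apply: sumr_ge0 => k _; exact: mxn_ge0.
rewrite mulr_suml; apply: le_trans (mxn_sum _ _ _) _; apply: ler_sum => k _.
rewrite mxnZ mulrC ler_wpM2l ?mxn_ge0//; apply: le_trans (binp_bound _ _) _.
by apply: ler_weXn2l; rewrite ?lerDl// -ltnS.
Qed.

End BinomialBounds.

(** * The fluctuation *)

Section JordanFlow.
Variables (R : realType) (m : nat) (lam : R[i]).
Hypothesis lam0 : lam != 0.

(* [flow t] is the real power [Lambda ^ t] of the Jordan block, see [flow1] and [flowD]. *)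
Definition flow (t : R) : 'M[R[i]]_m.+1 :=
  cexp (RC t * cLog lam) *: unipow (lam^-1 *: shiftmx _ m.+1) (RC t).

Let Xnil : (lam^-1 *: shiftmx R[i] m.+1) ^+ m.+1 = 0.
Proof. by rewrite exprZn shiftmx_nilp scaler0. Qed.

Lemma flow0 : flow 0 = 1%:M.
Proof. by rewrite /flow (_ : RC 0 = 0)// mul0r cexp0 scale1r unipow0. Qed.

Lemma flowD s t : flow (s + t) = flow s *m flow t.
Proof.
rewrite /flow RCD mulrDl cexpD unipowD// -scalemxAl -scalemxAr scalerA.
by rewrite mulmxE.
Qed.

Lemma flow1 : flow 1 = lam%:M + shiftmx _ m.+1.
Proof.
rewrite /flow (_ : RC 1 = 1)// mul1r cexp_cLog// unipow1// scalerDr scalerA divff//.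
by rewrite scale1r -[1]/(1%:M) scale_scalar_mx mulr1.
Qed.

Lemma flow_nat n : flow n%:R = (lam%:M + shiftmx _ m.+1) ^+ n.
Proof.
elim: n => [|n IHn]; first exact: flow0.
by rewrite -natr1 flowD IHn flow1 exprSr.
Qed.

Lemma flow_bound : exists2 c, 0 <= c &
  forall t, mxn (flow t) <= c * (1 + `|t|) ^+ m * cabs lam `^ t.
Proof.
have [c c0 hc] := unipow_bound (lam^-1 *: shiftmx R[i] m.+1).
by exists c => // t; rewrite mxnZ cabs_cexp_cLog// mulrC ler_wpM2r ?powR_ge0.
Qed.

Lemma flow_holder al : 0 < al <= 1 -> holder al (fun t => flow (- t)).
Proof.
move=> al01.
have hRC : cholder al (fun t => RC (- t)).
  apply: (lipschitz_cholder al01 (L := 1)) => // x y _ _.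
  by rewrite -RCN -RCD cabs_real mul1r opprK addrC distrC.
have hexp : cholder al (fun t => cexp (RC (- t) * cLog lam)).
  have [L L0 h] := cexp_cholder (- cLog lam) al01; exists L => // x y hx hy.
  by have := h x y hx hy; rewrite !RCN !mulrN !mulNr.
apply: (holderZ al01 hexp).
apply: (@holder_sum _ _ _ _ _ _ (fun (k : 'I_m.+1) (t : R) =>
  (binp _ k).[RC (- t)] *: (lam^-1 *: shiftmx _ m.+1) ^+ k)) => k.
by apply: (holderZ al01); [exact: (cholder_horner al01)|exact: holder_cst].
Qed.

End JordanFlow.

Section Decomposition.
Variables (R : realType) (q d m : nat) (A : nat -> 'M[R[i]]_d).
Variables (T J : 'M[R[i]]_d) (w : 'rV[R[i]]_d) (lam : R[i]).
Hypothesis q2 : (2 <= q)%N.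
Hypotheses (Tu : T \in unitmx) (TCJ : T *m Cmat q A *m invmx T = J) (Jj : is_jordan J).
Hypothesis wm : w *m (Cmat q A - lam%:M) ^+ m.+1 = 0.

Definition chain (k : nat) : 'rV[R[i]]_d := w *m (Cmat q A - lam%:M) ^+ k.

Definition chainmx : 'M[R[i]]_(m.+1, d) := \matrix_(i < m.+1) chain i.

Definition jordan_block : 'M[R[i]]_m.+1 := lam%:M + shiftmx _ m.+1.

Lemma chain0 : chain 0 = w.
Proof. by rewrite /chain expr0 mulmx1. Qed.

Lemma chainS k : chain k *m Cmat q A = lam *: chain k + chain k.+1.
Proof.
rewrite /chain exprSr -mulmxE mulmxA mulmxBr.
by rewrite [_ *m lam%:M]mul_mx_scalar [RHS]addrC subrK.
Qed.

Lemma chain_nil k : (m < k)%N -> chain k = 0.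
Proof. by move=> mk; rewrite /chain -(subnKC mk) exprD -mulmxE mulmxA wm mul0mx. Qed.

Lemma chain_gen k : chain k *m (Cmat q A - lam%:M) ^+ m.+1 = 0.
Proof. by rewrite /chain -mulmxA mulmxE -exprD addnC exprD -mulmxE mulmxA wm mul0mx. Qed.

Lemma row_chainmx i : row i chainmx = chain i.
Proof. exact: rowK. Qed.

Lemma chainmx_comm : chainmx *m Cmat q A = jordan_block *m chainmx.
Proof.
apply/row_matrixP => i; rewrite row_mul row_chainmx chainS mulmxDl linearD /=.
rewrite mul_scalar_mx linearZ /= row_chainmx; congr (_ + _).
have := row_shiftmxX chainmx i 1; rewrite expr1 => ->.
case: insubP => [j _ /= ji|]; first by rewrite row_chainmx ji addn1.
by rewrite -leqNgt addn1 => mi; apply: chain_nil.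
Qed.

Let K := Kmat T J (A 0%N).
Let G := chainmx *m (1%:M - A 0%N).

(* The sigma of the introduction, with argument [t = log_q N]. *)
Definition smooth_part (t : R) : 'M[R[i]]_(m.+1, d) :=
  chainmx *m Kmat T J (A 0%N) +
  (if lam == 1 then \sum_(k < m.+1) (binp _ k.+1).[RC t] *:
      (shiftmx _ m.+1 ^+ k *m (chainmx *m (1%:M - A 0%N))) else 0).

(** For [lam] != 1 this is the fixed-point equation of K, row by row. For [lam] = 1 the sum is
    formally ((1 + S)^t - 1) S^(-1) applied to V (1 - A_0), with S the shift matrix, and the
    recursion is Pascal's rule together with S^(m+1) = 0. *)
Lemma smooth_partS t :
  smooth_part (t + 1) = jordan_block *m smooth_part t + chainmx *m (1%:M - A 0%N).
Proof.
rewrite /smooth_part -/K -/G; have [l1|l1] := eqVneq lam 1; last first.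
  rewrite !addr0 mulmxA -chainmx_comm; apply/row_matrixP => i.
  rewrite linearD /= !row_mul !row_chainmx.
  exact: (Kmat_fixpoint _ Tu TCJ Jj l1 (chain_gen i)).
have -> : chainmx *m K = 0.
  apply/row_matrixP => i; rewrite row_mul row_chainmx row0.
  by apply: (Kmat_eigen1 _ Tu TCJ Jj (k := m.+1)); rewrite -l1 chain_gen.
move: (G) => G0; rewrite !add0r /jordan_block l1 mulmxDl mul1mx -addrA.
have -> : \sum_(k < m.+1) (binp R[i] k.+1).[RC (t + 1)] *: (shiftmx R[i] m.+1 ^+ k *m G0) =
    \sum_(k < m.+1) (binp R[i] k.+1).[RC t] *: (shiftmx R[i] m.+1 ^+ k *m G0) +
    \sum_(k < m.+1) (binp R[i] k).[RC t] *: (shiftmx R[i] m.+1 ^+ k *m G0).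
  rewrite -big_split; apply: eq_bigr => k _ /=.
  by rewrite RCD binp_pascal scalerDl.
congr (_ + _); rewrite big_ord_recl binp0 scale1r expr0 mul1mx addrC; congr (_ + _).
rewrite big_ord_recr /= mulmxDr -scalemxAr mulmxA mulmxE -exprS shiftmx_nilp mul0mx.
rewrite scaler0 addr0 mulmx_sumr; apply: eq_bigr => k _.
by rewrite -scalemxAr mulmxA mulmxE -exprS.
Qed.

Definition fluctuation (N : nat) : 'M[R[i]]_(m.+1, d) :=
  chainmx *m Fsum q A N - smooth_part (logq q N%:R).

Let lnq : 0 < ln (q%:R : R). Proof. by apply: ln_gt0; rewrite ltr1n. Qed.

Lemma logq_qM N : (0 < N)%N -> logq q (q * N)%:R = logq q N%:R + 1 :> R.
Proof.
move=> N0; rewrite /logq natrM lnM ?posrE ?ltr0n// ?(ltnW q2)//.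
by rewrite mulrDl divff ?gt_eqF// addrC.
Qed.

Lemma fluctuation_step N r : (0 < N)%N -> (r < q)%N ->
  fluctuation (q * N + r) = jordan_block *m fluctuation N +
    (chainmx *m Bmat A r *m fseq q A N -
     (smooth_part (logq q (q * N + r)%:R) - smooth_part (logq q (q * N)%:R))).
Proof.
move=> N0 rq; rewrite /fluctuation Fsum_qDr// (logq_qM N0) smooth_partS.
have -> : chainmx *m (Cmat q A *m Fsum q A N + (1%:M - A 0%N) + Bmat A r *m fseq q A N) =
    jordan_block *m (chainmx *m Fsum q A N) + chainmx *m (1%:M - A 0%N) +
    chainmx *m Bmat A r *m fseq q A N.
  by rewrite (mulmxDr _ (_ + _)) (mulmxDr _ (_ *m _)) !mulmxA chainmx_comm.
rewrite (mulmxBr jordan_block); have alg (a b c g s : 'M[R[i]]_(m.+1, d)) :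
    a + g + c - s = (a - b) + (c - (s - (b + g))).
  by apply/matrixP => i j; rewrite !mxE; ring.
exact: alg.
Qed.

Lemma fluctuation_qM N : (0 < N)%N ->
  fluctuation (q * N) = jordan_block *m fluctuation N.
Proof.
move=> N0; have := fluctuation_step N0 (ltnW q2); rewrite addn0 => ->.
by rewrite /Bmat big_ord0 mulmx0 mul0mx !subrr addr0.
Qed.

Lemma trunc_log_logq N : (0 < N)%N ->
  (trunc_log q N)%:R <= (logq q N%:R : R) < (trunc_log q N).+1%:R.
Proof.
move=> N0; have /andP[lo hi] := trunc_log_bounds q2 N0.
have qpos k : (q%:R : R) ^+ k \in Num.pos by rewrite posrE exprn_gt0// ltr0n ltnW.
have Npos : (N%:R : R) \in Num.pos by rewrite posrE ltr0n.
have q0 : (0 : R) < q%:R by rewrite ltr0n ltnW.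
rewrite /logq ler_pdivlMr// ltr_pdivrMr// !mulr_natl -!lnXn//.
by rewrite ler_ln// ltr_ln// -!natrX ler_nat ltr_nat lo hi.
Qed.

Lemma smooth_part_lipschitz : exists2 c, 0 <= c & forall s t B, `|s| <= B -> `|t| <= B ->
  mxn (smooth_part s - smooth_part t) <=
    if lam == 1 then c * (1 + B) ^+ m.+1 * `|s - t| else 0.
Proof.
pose Y (k : nat) := shiftmx R[i] m.+1 ^+ k *m (chainmx *m (1%:M - A 0%N)).
exists (\sum_(k < m.+1) k.+1%:R * mxn (Y k)).
  by apply: sumr_ge0 => k _; rewrite mulr_ge0 ?mxn_ge0.
move=> s t B hs ht; rewrite /smooth_part opprD addrACA subrr add0r.
case: eqP => _; last by rewrite subrr mxn0.
rewrite -sumrB -mulrA mulr_suml; apply: le_trans (mxn_sum _ _ _) _.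
apply: ler_sum => k _; rewrite -scalerBl mxnZ -/(Y k).
have B0 : 0 <= B by exact: le_trans hs.
have h := binp_lipschitz k.+1 hs ht.
rewrite [leRHS]mulrAC ler_wpM2r ?mxn_ge0//; apply: le_trans h _.
rewrite -!mulrA ler_wpM2l// ler_wpM2r//.
by apply: ler_weXn2l; rewrite ?lerDl.
Qed.

(** With n the integer part of log_q N, the logarithm moves by O(1/N) = O(q^(-n)). For [lam] = 1
    this is multiplied by a polynomial in n, which (q r)^n absorbs since q r > 1. The range j <= q
    covers both N + 1 and q N + r. *)
Lemma smooth_part_increment r : (lam = 1 -> 1 < q%:R * r) -> exists2 c, 0 <= c &
  forall N j, (0 < N)%N -> (j <= q)%N ->
    mxn (smooth_part (logq q (N + j)%:R) - smooth_part (logq q N%:R)) <= c * r ^+ trunc_log q N.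
Proof.
move=> hr; have [c c0 hc] := smooth_part_lipschitz.
have [l1|l1] := eqVneq lam 1; last first.
  exists 0 => // N j _ _; rewrite mul0r.
  have := hc (logq q (N + j)%:R) (logq q N%:R) (`|logq q (N + j)%:R| + `|logq q N%:R|).
  by rewrite (negbTE l1); apply; rewrite ?lerDl ?lerDr.
have [p p0 hp] := polynomial_le_geometric m.+1 (hr l1).
have q0 : (0 : R) < q%:R by rewrite ltr0n ltnW.
exists (c * (3 ^+ m.+1 * p) * (q%:R / ln q%:R)).
  by rewrite !mulr_ge0 ?exprn_ge0 ?invr_ge0// ltW.
move=> N j N0 jq; set n := trunc_log q N.
have /andP[lo hi] := trunc_log_bounds q2 N0; rewrite -/n in lo hi.
have Nj0 : (0 < N + j)%N by rewrite addn_gt0 N0.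
have /andP[t0 t1] := trunc_log_logq N0; have /andP[s0 s1] := trunc_log_logq Nj0.
have tN : `|logq q N%:R| <= n%:R + 2 :> R.
  rewrite ger0_norm ?(le_trans _ t0)//; apply: le_trans (ltW t1) _.
  by rewrite -natr1 lerD2l ler1n.
have sN : `|logq q (N + j)%:R| <= n%:R + 2 :> R.
  rewrite ger0_norm ?(le_trans _ s0)//; apply: le_trans (ltW s1) _.
  rewrite -natrD ler_nat addn2 ltnS -ltnS -(ltn_exp2l _ _ q2).
  apply: leq_ltn_trans (trunc_logP q2 Nj0) _.
  have qn : (q <= q ^ n.+1)%N by rewrite -{1}[q]expn1 leq_exp2l.
  apply: (@leq_trans (q ^ n.+1 + q ^ n.+1)%N).
    by rewrite -addSn; apply: leq_add => //; exact: leq_trans jq qn.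
  by rewrite addnn -mul2n [(q ^ n.+2)%N]expnS leq_mul2r q2 orbT.
have dN : `|logq q (N + j)%:R - logq q N%:R| <= q%:R / ln q%:R * q%:R ^- n :> R.
  have N0' : (0 : R) < N%:R by rewrite ltr0n.
  rewrite /logq -mulrBl normrM (gtr0_norm (x := (ln q%:R)^-1)) ?invr_gt0//.
  rewrite mulrAC ler_wpM2r ?invr_ge0 ?(ltW lnq)// -ln_div ?posrE ?ltr0n//.
  have -> : (N + j)%:R / N%:R = 1 + j%:R / N%:R :> R.
    by rewrite natrD mulrDl divff// gt_eqF.
  have jN : (0 : R) <= j%:R / N%:R by rewrite divr_ge0// ltW.
  rewrite ger0_norm ?ln_ge0 ?lerDl//; apply: le_trans (le_ln1Dx _) _.
    by apply: lt_le_trans jN; rewrite oppr_lt0.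
  apply: ler_pM; rewrite ?invr_ge0 ?ler_nat// ?(ltW N0')//.
  by rewrite lef_pV2 ?posrE ?exprn_gt0// -natrX ler_nat.
have := hc _ _ _ sN tN; rewrite l1 eqxx => h; apply: le_trans h _.
rewrite -!mulrA ler_wpM2l//.
(* The power of 3 comes from n + 3 <= 3 (n + 1). *)
have pol : (1 + (n%:R + 2)) ^+ m.+1 <= 3 ^+ m.+1 * (p * (q%:R ^+ n * r ^+ n)) :> R.
  apply: (@le_trans _ _ (3 ^+ m.+1 * n.+1%:R ^+ m.+1)).
    rewrite -exprMn; apply: lerXn2r; rewrite ?nnegrE ?addr_ge0 ?mulr_ge0//.
    by rewrite -natr1; have : (0 : R) <= n%:R by []; lra.
  by rewrite ler_wpM2l ?exprn_ge0// -exprMn.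
apply: le_trans (ler_pM _ _ pol dN) _; rewrite ?exprn_ge0 ?addr_ge0//.
rewrite le_eqVlt; apply/orP; left; apply/eqP; field.
by rewrite !gt_eqF ?exprn_gt0.
Qed.

(* For [lam = 1] the increments of [smooth_part] are only of size
   [(log N) ^ m / N], whence the condition on [r]. *)
Lemma fluctuation_bounds r cf : 0 < r -> (lam = 1 -> 1 < q%:R * r) -> 0 <= cf ->
  (forall N, (0 < N)%N -> mxn (fseq q A N) <= cf * r ^+ trunc_log q N) ->
  exists2 c, 0 <= c &
   (forall N, (q <= N)%N ->
     mxn (fluctuation N - jordan_block *m fluctuation (N %/ q)) <= c * r ^+ trunc_log q N) /\
   (forall N, (0 < N)%N ->
     mxn (fluctuation N.+1 - fluctuation N) <= c * r ^+ trunc_log q N).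
Proof.
move=> r0 hr cf0 hf; have [c c0 hc] := smooth_part_increment hr.
pose b : R := \sum_(s < q) mxn (A s).
have b0 : 0 <= b by apply: sumr_ge0 => s _; exact: mxn_ge0.
have hB s : (s <= q)%N -> mxn (Bmat A s) <= b.
  move=> sq; apply: le_trans (mxn_sum _ _ _) _.
  rewrite /b -(subnKC sq) big_split_ord /= lerDl sumr_ge0// => k _; exact: mxn_ge0.
have V0 := mxn_ge0 chainmx.
(* The division by r is due to f being taken at [N %/ q], which has one digit fewer than N. *)
exists (mxn chainmx * b * cf / r + mxn chainmx * cf + c).
  by rewrite !addr_ge0 ?divr_ge0 ?mulr_ge0// ltW.
split=> N N0.
  have Nq0 : (0 < N %/ q)%N by rewrite divn_gt0// ltnW.
  have rq : (N %% q < q)%N by rewrite ltn_mod ltnW.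
  have Ne : N = (q * (N %/ q) + N %% q)%N by rewrite mulnC -divn_eq.
  have tN : trunc_log q N = (trunc_log q (N %/ q)).+1 by rewrite {1}Ne trunc_log_qDr.
  have tqN : trunc_log q (q * (N %/ q)) = trunc_log q N.
    by rewrite tN -[(q * _)%N]addn0 trunc_log_qDr// ltnW.
  rewrite {1}Ne fluctuation_step// addrC addKr; apply: le_trans (mxnB _ _) _.
  rewrite 2!mulrDl; apply: lerD; last first.
    by rewrite -tqN; apply: hc => //; [rewrite muln_gt0 Nq0 ltnW|exact: ltnW].
  apply: ler_wpDr; first by rewrite !mulr_ge0// exprn_ge0// ltW.
  apply: le_trans (mxnM _ _) _; rewrite tN exprS.
  have -> : mxn chainmx * b * cf / r * (r * r ^+ trunc_log q (N %/ q)) =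
      mxn chainmx * b * (cf * r ^+ trunc_log q (N %/ q)).
    by field; rewrite gt_eqF.
  apply: ler_pM; rewrite ?mxn_ge0//; last exact: hf.
  by apply: le_trans (mxnM _ _) _; rewrite ler_wpM2l// hB// ltnW.
have -> : fluctuation N.+1 - fluctuation N = chainmx *m fseq q A N -
    (smooth_part (logq q (N + 1)%:R) - smooth_part (logq q N%:R)).
  rewrite /fluctuation -[N.+1]addn1 Fsum_add big_ord1 addn0 (mulmxDr chainmx).
  move: (smooth_part _) (smooth_part _) (chainmx *m _) (chainmx *m _) => s1 s2 a e.
  by apply/matrixP => i j; rewrite !mxE; ring.
apply: le_trans (mxnB _ _) _; rewrite 2!mulrDl -[leRHS]addrA; apply: ler_wpDl.
  by rewrite !mulr_ge0 ?invr_ge0 ?exprn_ge0// ltW.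
apply: lerD; last by apply: hc => //; exact: ltnW.
by apply: le_trans (mxnM _ _) _; rewrite -mulrA ler_wpM2l// hf.
Qed.

(** P(N) = Lambda P(N %/ q) + error is unrolled down to N < q; the error of step i is multiplied by
    Lambda^i. The bound [a] is left open because |lam| < R and |lam| = R call for different ones. *)
Lemma fluctuation_iter (a : nat -> R) c r :
  (forall i, mxn (jordan_block ^+ i) <= a i) ->
  (forall N, (q <= N)%N ->
     mxn (fluctuation N - jordan_block *m fluctuation (N %/ q)) <= c * r ^+ trunc_log q N) ->
  forall N, (0 < N)%N -> mxn (fluctuation N) <=
    a (trunc_log q N) * (\sum_(k < q) mxn (fluctuation k)) +
    \sum_(i < trunc_log q N) a i * (c * r ^+ (trunc_log q N - i)).
Proof.
move=> ha hstep.
have a0 i : 0 <= a i by exact: le_trans (mxn_ge0 _) (ha i).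
(* [j] counts the factors Lambda already pulled out. *)
suff gen n N j : (0 < N)%N -> trunc_log q N = n ->
    mxn (jordan_block ^+ j *m fluctuation N) <=
    a (j + n)%N * (\sum_(k < q) mxn (fluctuation k)) +
    \sum_(i < n) a (j + i)%N * (c * r ^+ (n - i)).
  by move=> N N0; have := gen _ N 0%N N0 erefl; rewrite expr0 mul1mx.
elim: n N j => [|n IHn] N j N0 tN.
  rewrite big_ord0 addr0 addn0; apply: le_trans (mxnM _ _) _.
  apply: ler_pM; rewrite ?mxn_ge0//.
  have Nq : (N < q)%N.
    by have /andP[_] := trunc_log_bounds q2 N0; rewrite tN expn1.
  rewrite (bigD1 (Ordinal Nq))//= lerDl sumr_ge0// => k _; exact: mxn_ge0.
have qN : (q <= N)%N.
  have /andP[+ _] := trunc_log_bounds q2 N0; rewrite tN; apply: leq_trans.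
  by rewrite -{1}[q]expn1 leq_exp2l.
have Nq0 : (0 < N %/ q)%N by rewrite divn_gt0// ltnW.
have tNq : trunc_log q (N %/ q) = n.
  apply: succn_inj; rewrite -tN {2}(divn_eq N q) mulnC trunc_log_qDr//.
  by rewrite ltn_mod ltnW.
have -> : jordan_block ^+ j *m fluctuation N =
    jordan_block ^+ j *m (fluctuation N - jordan_block *m fluctuation (N %/ q)) +
    jordan_block ^+ j.+1 *m fluctuation (N %/ q).
  by rewrite exprSr -mulmxE -mulmxA (mulmxBr _ (fluctuation N)) subrK.
apply: le_trans (mxnD _ _) _; have h := IHn (N %/ q)%N j.+1 Nq0 tNq.
rewrite addrC; apply: le_trans (lerD h (lexx _)) _.
rewrite addSnnS -addrA lerD2l big_ord_recl addn0 subn0 addrC; apply: lerD.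
  apply: le_trans (mxnM _ _) _; apply: ler_pM; rewrite ?mxn_ge0//.
  by rewrite -tN; exact: hstep.
by apply: ler_sum => i _; rewrite /= /bump add1n addSnnS subSS.
Qed.

(** Besides w K, the first row of [smooth_part] has these coefficients at t^j for j <= m; the one at
    t^(m+1) is w theta. *)
Definition smooth_coef (j : nat) : 'rV[R[i]]_d :=
  if lam == 1 then \sum_(k < m.+1) (binp _ k.+1)`_j *: (chain k *m (1%:M - A 0%N)) else 0.

Lemma row_smooth_part t :
  row ord0 (smooth_part t) = w *m Kmat T J (A 0%N) +
    RC (t ^+ m.+1) *: (w *m theta T J (Cmat q A) (A 0%N) m.+1) +
    \sum_(j < m.+1) RC (t ^+ j) *: smooth_coef j.
Proof.
rewrite /smooth_part linearD /= row_mul row_chainmx chain0 -addrA; congr (_ + _).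
rewrite (thetaE _ Tu TCJ Jj m.+1 wm) /smooth_coef.
have [l1|l1] := eqVneq lam 1; last first.
  by rewrite row0 scaler0 add0r big1// => j _; rewrite scaler0.
have -> : row ord0 (\sum_(k < m.+1) (binp R[i] k.+1).[RC t] *:
      (shiftmx R[i] m.+1 ^+ k *m (chainmx *m (1%:M - A 0%N)))) =
    \sum_(k < m.+1) (binp R[i] k.+1).[RC t] *: (chain k *m (1%:M - A 0%N)).
  rewrite linear_sum /=; apply: eq_bigr => k _.
  rewrite linearZ /= row_shiftmxX add0n valK row_mul row_chainmx.
  by [].
transitivity (\sum_(j < m.+2) RC (t ^+ j) *:
    (\sum_(k < m.+1) (binp R[i] k.+1)`_j *: (chain k *m (1%:M - A 0%N)))).
  rewrite (eq_bigr (fun k : 'I_m.+1 => \sum_(j < m.+2)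
    RC (t ^+ j) *: ((binp R[i] k.+1)`_j *: (chain k *m (1%:M - A 0%N))))); last first.
    move=> k _; have -> : (binp R[i] k.+1).[RC t] =
        \sum_(j < m.+2) (binp R[i] k.+1)`_j * RC t ^+ j.
      by apply: binp_expand; rewrite ltnS.
    rewrite scaler_suml.
    by apply: eq_bigr => j _; rewrite scalerA mulrC RCX.
  by rewrite exchange_big; apply: eq_bigr => j _; rewrite scaler_sumr.
rewrite [LHS]big_ord_recr [LHS]addrC /=; congr (_ + _); congr (_ *: _).
(* Only the summand k = m reaches degree m + 1, with leading coefficient 1/(m+1)!. *)
rewrite big_ord_recr /= big1 ?add0r; last first.
  move=> k _; have sz : (size (binp R[i] k.+1) <= m.+1)%N.
    by apply: leq_trans (size_binp _ _) _; rewrite ltnS.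
  by rewrite (nth_default _ sz) scale0r.
by rewrite (lead_binp _ m.+1) /chain l1.
Qed.

(** Common starting point of the three claims: only the first row of P and the lower powers of log_q
    N remain to be estimated or expanded. *)
Lemma main_difference N :
  w *m Fsum q A N - (w *m Kmat T J (A 0%N) +
    RC (logq q N%:R ^+ m.+1) *: (w *m theta T J (Cmat q A) (A 0%N) m.+1)) =
  row ord0 (fluctuation N) + \sum_(j < m.+1) RC (logq q N%:R ^+ j) *: smooth_coef j.
Proof.
rewrite /fluctuation [row _ _]linearB /= row_smooth_part row_mul row_chainmx chain0.
have alg (a b c : 'rV[R[i]]_d) : a - b = a - (b + c) + c by rewrite opprD addrA subrK.
exact: alg.
Qed.

End Decomposition.

(** * Eigenvalues of modulus at most R *)

Section JordanBlockGrowth.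
Variables (R : realType) (m : nat) (lam : R[i]).
Local Notation Lambda := (jordan_block m lam).

Lemma jordan_block_bound : lam != 0 -> exists2 c, 0 <= c &
  forall n, mxn (Lambda ^+ n) <= c * n.+1%:R ^+ m * cabs lam ^+ n.
Proof.
move=> l0; have [c c0 hc] := flow_bound m l0; exists c => // n.
rewrite -(flow_nat m l0); apply: le_trans (hc _) _.
by rewrite normr_nat -natr1 addrC powR_mulrn ?cabs_ge0.
Qed.

Lemma jordan_block_geometric mu : cabs lam < mu -> exists2 c, 0 <= c &
  forall n, mxn (Lambda ^+ n) <= c * mu ^+ n.
Proof.
move=> lmu; have mu0 : 0 < mu by exact: le_lt_trans (cabs_ge0 _) lmu.
(* The bound through [flow] requires [lam] != 0; for [lam] = 0 the block is nilpotent and only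
   finitely many powers have to be bounded. *)
have [l0|l0] := eqVneq lam 0.
  exists (\sum_(k < m.+1) mxn (shiftmx R[i] m.+1 ^+ k) * mu ^- k) => [|n].
    by apply: sumr_ge0 => k _; rewrite mulr_ge0 ?mxn_ge0// invr_ge0 exprn_ge0// ltW.
  have e : Lambda = shiftmx R[i] m.+1 by rewrite /jordan_block l0 raddf0 add0r.
  have [nm|nm] := ltnP n m.+1; last first.
    rewrite e -(subnKC nm) exprD shiftmx_nilp mul0r mxn0 mulr_ge0 ?exprn_ge0 ?(ltW mu0)//.
    by apply: sumr_ge0 => k _; rewrite mulr_ge0 ?mxn_ge0// invr_ge0 exprn_ge0// ltW.
  rewrite e (bigD1 (Ordinal nm))//= mulrDl divfK ?gt_eqF ?exprn_gt0// lerDl.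
  rewrite mulr_ge0 ?exprn_ge0 ?(ltW mu0)//.
  by apply: sumr_ge0 => k _; rewrite mulr_ge0 ?mxn_ge0// invr_ge0 exprn_ge0// ltW.
have [c c0 hc] := jordan_block_bound l0.
have lp : 0 < cabs lam by rewrite cabs_gt0.
have x1 : 1 < mu / cabs lam by rewrite ltr_pdivlMr// mul1r.
have [p p0 hp] := polynomial_le_geometric m x1.
exists (c * p) => [|n]; first by rewrite mulr_ge0// ltW.
apply: le_trans (hc n) _; rewrite -!mulrA ler_wpM2l//.
apply: (@le_trans _ _ ((p * (mu / cabs lam) ^+ n) * cabs lam ^+ n)).
  by rewrite ler_wpM2r ?exprn_ge0 ?(ltW lp).
by rewrite -mulrA -exprMn divfK// gt_eqF.
Qed.

End JordanBlockGrowth.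

Section SmallEigenvalue.
Variables (R : realType) (q d m : nat) (A : nat -> 'M[R[i]]_d).
Variables (T J : 'M[R[i]]_d) (w : 'rV[R[i]]_d) (lam : R[i]).
Variables (nv : 'rV[R[i]]_d -> R) (Rb : R).
Hypothesis q2 : (2 <= q)%N.
Hypotheses (Tu : T \in unitmx) (TCJ : T *m Cmat q A *m invmx T = J) (Jj : is_jordan J).
Hypothesis wm : w *m (Cmat q A - lam%:M) ^+ m.+1 = 0.
Hypothesis nvP : is_vnorm nv.
Hypothesis RbP : (finiteness q nv A /\ Rb = jsr q nv A) \/ jsr q nv A < Rb.

Local Notation fluct := (fluctuation q m A T J w lam).
Local Notation Lambda := (jordan_block m lam).

Lemma smooth_coef_bound : exists2 c, 0 <= c & forall N, (0 < N)%N ->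
  mxn (\sum_(j < m.+1) RC (logq q N%:R ^+ j) *: smooth_coef q m A w lam j) <=
  if lam == 1 then c * (trunc_log q N).+1%:R ^+ m else 0.
Proof.
exists (\sum_(j < m.+1) mxn (smooth_coef q m A w lam j)).
  by apply: sumr_ge0 => j _; exact: mxn_ge0.
move=> N N0; case: eqP => l1; last first.
  rewrite big1 ?mxn0// => j _; rewrite /smooth_coef; case: eqP => //.
  by rewrite scaler0.
have /andP[t0 t1] := trunc_log_logq R q2 N0.
have tp : (0 : R) <= logq q N%:R by exact: le_trans t0.
apply: le_trans (mxn_sum _ _ _) _; rewrite mulr_suml; apply: ler_sum => j _.
rewrite mxnZ mulrC ler_wpM2l ?mxn_ge0// cabs_real ger0_norm ?exprn_ge0//.
apply: (@le_trans _ _ ((trunc_log q N).+1%:R ^+ j)).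
  by apply: lerXn2r; rewrite ?nnegrE// ltW.
by apply: ler_weXn2l; rewrite ?ler1n// -ltnS.
Qed.

(** The two exponents differ by less than 1; the factor 1 + 1/R covers R >= 1 as well as R < 1. *)
Lemma pow_trunc_log N : 0 < Rb -> (0 < N)%N ->
  Rb ^+ trunc_log q N <= (1 + Rb^-1) * Rb `^ logq q N%:R.
Proof.
move=> Rb0 N0; have /andP[t0 t1] := trunc_log_logq R q2 N0.
set n := trunc_log q N in t0 t1 *; set t := logq q N%:R in t0 t1 *.
have p0 : 0 <= Rb `^ t by exact: powR_ge0.
have i0 : 0 < Rb^-1 by rewrite invr_gt0.
have [R1|R1] := leP 1 Rb.
  apply: (@le_trans _ _ (Rb `^ t)); last by rewrite ler_peMl// lerDl ltW.
  by rewrite -powR_mulrn ?(ltW Rb0)//; exact: ler_powR.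
apply: (@le_trans _ _ (Rb^-1 * Rb `^ t)); last by rewrite ler_wpM2r// lerDr.
rewrite ler_pdivlMl// -exprS -powR_mulrn ?(ltW Rb0)//.
by apply: ger_powR; rewrite ?Rb0 ltW.
Qed.

Let D N : 'rV[R[i]]_d := w *m Fsum q A N - (w *m Kmat T J (A 0%N) +
    RC (logq q N%:R ^+ m.+1) *: (w *m theta T J (Cmat q A) (A 0%N) m.+1)).

Let D_le N : mxn (D N) <= mxn (fluct N) +
  mxn (\sum_(j < m.+1) RC (logq q N%:R ^+ j) *: smooth_coef q m A w lam j).
Proof.
rewrite /D (main_difference Tu TCJ Jj wm); apply: le_trans (mxnD _ _) _.
by rewrite lerD2r mxn_row.
Qed.

Let B0 : R := \sum_(k < q) mxn (fluct k).
Let B0_ge0 : 0 <= B0. Proof. by apply: sumr_ge0 => k _; exact: mxn_ge0. Qed.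

Lemma remainder_small : cabs lam < Rb -> exists (c : R) (N0 : nat),
  forall N, (N0 <= N)%N -> nv (D N) <= c * Rb `^ logq q N%:R.
Proof.
move=> lR; have Rb0 : 0 < Rb by exact: le_lt_trans (cabs_ge0 _) lR.
have [cf cf0 hf] := fseq_bound q2 nvP RbP Rb0 (lexx _).
have l1R : lam = 1 -> 1 < Rb by move=> l1; rewrite l1 cabs1 in lR.
have q1 : (1 : R) < q%:R by rewrite ltr1n.
have hr : lam = 1 -> 1 < q%:R * Rb.
  by move=> /l1R R1; rewrite -[ltLHS]mulr1; apply: ltr_pM.
have [c c0 [hstep _]] := fluctuation_bounds q2 Tu TCJ Jj wm Rb0 hr cf0 hf.
(* The gap between |lam| and mu absorbs the polynomial factor of Lambda^n; the gap between mu and R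
   makes the sum of the errors geometric. *)
pose mu := (cabs lam + Rb) / 2.
have lmu : cabs lam < mu by rewrite /mu; lra.
have muR : mu < Rb by rewrite /mu; lra.
have mu0 : 0 < mu by exact: le_lt_trans (cabs_ge0 _) lmu.
have [a a0 ha] := jordan_block_geometric m lmu.
have hP := fluctuation_iter q2 ha hstep.
pose x := mu / Rb.
have x0 : 0 <= x by rewrite divr_ge0// ltW.
have x1 : 0 < 1 - x by rewrite subr_gt0 /x ltr_pdivrMr// mul1r.
have geo n : \sum_(i < n) x ^+ i <= (1 - x)^-1.
  rewrite -[leRHS]mul1r ler_pdivlMr// mulrC -opprB mulNr -subrX1 opprB.
  by rewrite lerBlDr lerDl exprn_ge0.
have PN N : (0 < N)%N -> mxn (fluct N) <=
    (a * B0 + a * c / (1 - x)) * Rb ^+ trunc_log q N.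
  move=> N0; apply: le_trans (hP N N0) _; rewrite mulrDl; set n := trunc_log q N.
  have muX k : mu ^+ k <= Rb ^+ k by apply: lerXn2r; rewrite ?nnegrE ltW.
  apply: lerD; first by rewrite mulrAC -/B0; apply: ler_wpM2l => //; exact: mulr_ge0.
  apply: (@le_trans _ _ (a * c * Rb ^+ n * \sum_(i < n) x ^+ i)); last first.
    rewrite [leRHS]mulrAC; apply: ler_wpM2l => //.
    by rewrite !mulr_ge0// exprn_ge0// ltW.
  rewrite mulr_sumr; apply: ler_sum => i _.
  have -> : Rb ^+ n = Rb ^+ (n - i) * Rb ^+ i by rewrite -exprD subnK// ltnW.
  rewrite le_eqVlt; apply/orP; left; apply/eqP.
  have -> : mu ^+ i = x ^+ i * Rb ^+ i by rewrite -exprMn divfK// gt_eqF.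
  ring.
have [s s0 hs] := smooth_coef_bound.
(* If [lam] = 1 then R > 1, so the powers of log_q N are dominated by R^n. *)
have [p p0 hp] : exists2 p, 0 <= p & forall N, (0 < N)%N ->
    mxn (\sum_(j < m.+1) RC (logq q N%:R ^+ j) *: smooth_coef q m A w lam j) <=
    p * Rb ^+ trunc_log q N.
  have [l1|l1] := eqVneq lam 1; last first.
    by exists 0 => // N N0; have := hs N N0; rewrite (negbTE l1) mul0r.
  have [p p0 hp] := polynomial_le_geometric m (l1R l1).
  exists (s * p) => [|N N0]; first by rewrite mulr_ge0// ltW.
  have := hs N N0; rewrite l1 eqxx => h; apply: le_trans h _.
  by rewrite -mulrA ler_wpM2l.
have [k k0 hk] := vnorm_le_mxn nvP.
exists (k * ((a * B0 + a * c / (1 - x) + p) * (1 + Rb^-1))), 1%N => N N0.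
apply: le_trans (hk _) _; rewrite -[leRHS]mulrA ler_wpM2l ?(ltW k0)// -[leRHS]mulrA.
apply: le_trans (D_le _) _; apply: le_trans (lerD (PN _ N0) (hp _ N0)) _.
rewrite -mulrDl ler_wpM2l ?pow_trunc_log//.
by rewrite addr_ge0// addr_ge0 ?mulr_ge0// invr_ge0 ltW.
Qed.

Lemma remainder_critical : cabs lam = Rb -> exists (c : R) (N0 : nat),
  forall N, (N0 <= N)%N -> nv (D N) <= c * (Rb `^ logq q N%:R * ln N%:R ^+ m.+1).
Proof.
move=> lR; have Rb0 : 0 <= Rb by rewrite -lR cabs_ge0.
have q1 : (1 : R) < q%:R by rewrite ltr1n.
have lnq : 0 < ln (q%:R : R) by exact: ln_gt0.
(* R = 0 forces [lam] = 0: Lambda is nilpotent and f vanishes at all arguments with enough digits,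
   so the remainder is 0 for large N. *)
have [Rz|Rnz] := eqVneq Rb 0.
  have lz : lam = 0 by apply: cabs_eq0; rewrite lR.
  have l1 : lam != 1 by rewrite lz eq_sym oner_eq0.
  have [l hl] := fseq_nilp q2 nvP RbP Rz.
  have step N : (0 < N)%N -> (l < trunc_log q N)%N ->
      fluct N = Lambda *m fluct (N %/ q) /\ (0 < N %/ q)%N /\
      trunc_log q N = (trunc_log q (N %/ q)).+1.
    move=> N0 lN.
    have qN : (q <= N)%N.
      rewrite leqNgt; apply: contraL lN => Nq; rewrite -leqNgt.
      suff -> : trunc_log q N = 0%N by [].
      by apply: trunc_log_eq => //; rewrite expn0 expn1 N0.
    have Nq0 : (0 < N %/ q)%N by rewrite divn_gt0// ltnW.
    have rq : (N %% q < q)%N by rewrite ltn_mod ltnW.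
    have Ne : N = (q * (N %/ q) + N %% q)%N by rewrite mulnC -divn_eq.
    have tN : trunc_log q N = (trunc_log q (N %/ q)).+1 by rewrite {1}Ne trunc_log_qDr.
    split=> //; rewrite {1}Ne (fluctuation_step q2 Tu TCJ Jj wm)// hl//; last first.
      by rewrite -ltnS -tN.
    by rewrite mulmx0 /smooth_part (negbTE l1) subrr subrr addr0.
  have iter k : forall N, (0 < N)%N -> (l + k <= trunc_log q N)%N ->
      exists M, fluct N = Lambda ^+ k *m fluct M.
    elim: k => [|k IHk] N N0 lN; first by exists N; rewrite expr0 mul1mx.
    have [|-> [Nq0 tN]] := step N N0.
      by apply: leq_trans lN; rewrite addnS ltnS leq_addr.
    have [|M ->] := IHk _ Nq0; first by rewrite -ltnS -tN -addnS.
    by exists M; rewrite mulmxA mulmxE -exprS.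
  exists 0, (q ^ (l + m.+1))%N => N hN.
  have N0 : (0 < N)%N by apply: leq_trans hN; rewrite expn_gt0 ltnW.
  have [M PM] := iter m.+1 N N0 (trunc_log_max q2 hN).
  have Lz : Lambda ^+ m.+1 = 0 by rewrite /jordan_block lz raddf0 add0r shiftmx_nilp.
  have -> : D N = 0.
    rewrite /D (main_difference Tu TCJ Jj wm) PM Lz mul0mx row0 add0r big1// => j _.
    by rewrite /smooth_coef (negbTE l1) scaler0.
  by rewrite vnorm0// mul0r.
have Rp : 0 < Rb by rewrite lt_def Rnz.
have l0 : lam != 0 by rewrite -cabs_gt0 lR.
have [cf cf0 hf] := fseq_bound q2 nvP RbP Rp (lexx _).
have l1R : lam = 1 -> Rb = 1 by move=> l1; rewrite -lR l1 cabs1.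
have hr : lam = 1 -> 1 < q%:R * Rb by move=> /l1R ->; rewrite mulr1.
have [c c0 [hstep _]] := fluctuation_bounds q2 Tu TCJ Jj wm Rp hr cf0 hf.
have [a a0 ha] := jordan_block_bound m l0; rewrite lR in ha.
have hP := fluctuation_iter q2 ha hstep.
have PN N : (0 < N)%N -> mxn (fluct N) <=
    (a * B0 + a * c) * ((trunc_log q N).+1%:R ^+ m.+1 * Rb ^+ trunc_log q N).
  move=> N0; apply: le_trans (hP N N0) _; rewrite mulrDl; set n := trunc_log q N.
  have n1 : (1 : R) <= n.+1%:R by rewrite ler1n.
  have Rn : 0 <= Rb ^+ n by rewrite exprn_ge0.
  apply: lerD.
    rewrite -/B0 [leRHS]mulrAC ler_wpM2r// -mulrA ler_wpM2l// ler_wpM2r//.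
    by apply: ler_weXn2l.
  (* The errors and Lambda^i have the same exponential rate, so each of the n summands is only
     bounded by n^m R^n up to constants; their number gives the extra factor n. *)
  apply: (@le_trans _ _ (\sum_(i < n) a * c * (n.+1%:R ^+ m * Rb ^+ n))).
    apply: ler_sum => i _.
    have -> : a * i.+1%:R ^+ m * Rb ^+ i * (c * Rb ^+ (n - i)) =
        a * c * (i.+1%:R ^+ m * Rb ^+ n).
      have -> : Rb ^+ n = Rb ^+ (n - i) * Rb ^+ i by rewrite -exprD subnK// ltnW.
      ring.
    rewrite ler_wpM2l ?mulr_ge0// ler_wpM2r//.
    by apply: lerXn2r; rewrite ?nnegrE// ler_nat ltnS ltnW.
  rewrite sumr_const card_ord -[_ *+ n]mulr_natl mulrCA ler_wpM2l ?mulr_ge0//.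
  rewrite exprS -mulrA ler_wpM2r ?mulr_ge0 ?exprn_ge0//.
  by rewrite ler_nat.
have [s s0 hs] := smooth_coef_bound.
have [k k0 hk] := vnorm_le_mxn nvP.
(* For N >= q one has n + 1 <= 2 n <= 2 log_q N = x ln N. *)
pose x : R := 2 / ln q%:R.
have x0 : 0 <= x by rewrite divr_ge0// ltW.
exists (k * ((a * B0 + a * c + s) * (x ^+ m.+1 * (1 + Rb^-1)))), q => N qN.
have N0 : (0 < N)%N by apply: leq_trans qN; exact: ltnW.
set n := trunc_log q N.
have n1 : (1 : R) <= n.+1%:R by rewrite ler1n.
have Rn : 0 <= Rb ^+ n by rewrite exprn_ge0.
have sN : mxn (\sum_(j < m.+1) RC (logq q N%:R ^+ j) *: smooth_coef q m A w lam j) <=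
    s * (n.+1%:R ^+ m.+1 * Rb ^+ n).
  apply: le_trans (hs N N0) _; case: eqP => [l1|_]; last first.
    by rewrite !mulr_ge0// exprn_ge0.
  by rewrite (l1R l1) expr1n mulr1 ler_wpM2l//; apply: ler_weXn2l.
have nln : n.+1%:R <= x * ln N%:R.
  have /andP[t0 _] := trunc_log_logq R q2 N0.
  have n0 : (0 < n)%N by apply: trunc_log_max => //; rewrite expn1.
  apply: (@le_trans _ _ (2 * logq q N%:R)); last first.
    by rewrite /x /logq mulrAC mulrA.
  apply: (@le_trans _ _ (2 * n%:R)); last by rewrite ler_wpM2l.
  by rewrite -natrM ler_nat mul2n -addnn -addn1 leq_add2l.
have lnN : 0 <= ln (N%:R : R) by apply: ln_ge0; rewrite ler1n.
apply: le_trans (hk _) _; rewrite -[leRHS]mulrA ler_wpM2l ?(ltW k0)// -[leRHS]mulrA.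
apply: le_trans (D_le _) _; apply: le_trans (lerD (PN _ N0) sN) _.
rewrite -mulrDl -[in leRHS](mulrA (x ^+ m.+1)); apply: ler_wpM2l.
  by rewrite addr_ge0// addr_ge0// mulr_ge0.
have -> : x ^+ m.+1 * ((1 + Rb^-1) * (Rb `^ logq q N%:R * ln N%:R ^+ m.+1)) =
  (x * ln N%:R) ^+ m.+1 * ((1 + Rb^-1) * Rb `^ logq q N%:R).
  by rewrite (exprMn _ x (ln _)) mulrACA; ring.
apply: ler_pM => //.
  by apply: lerXn2r; rewrite ?nnegrE// mulr_ge0.
exact: pow_trunc_log.
Qed.

End SmallEigenvalue.

(** * Eigenvalues of modulus greater than R *)

Section LargeEigenvalue.
Variables (R : realType) (q d m : nat) (A : nat -> 'M[R[i]]_d).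
Variables (T J : 'M[R[i]]_d) (w : 'rV[R[i]]_d) (lam : R[i]).
Variables (nv : 'rV[R[i]]_d -> R) (Rb : R).
Hypothesis q2 : (2 <= q)%N.
Hypotheses (Tu : T \in unitmx) (TCJ : T *m Cmat q A *m invmx T = J) (Jj : is_jordan J).
Hypothesis wm : w *m (Cmat q A - lam%:M) ^+ m.+1 = 0.
Hypothesis w0 : w *m (Cmat q A - lam%:M) ^+ m != 0.
Hypothesis nvP : is_vnorm nv.
Hypothesis RbP : (finiteness q nv A /\ Rb = jsr q nv A) \/ jsr q nv A < Rb.
Hypothesis lR : Rb < cabs lam.

Local Notation fluct := (fluctuation q m A T J w lam).
Local Notation Lambda := (jordan_block m lam).
Local Notation flow := (flow m lam).
Local Notation chain := (chain q A w lam).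
Local Notation eta := (logq q (cabs lam / Rb)).

Let q0 : (0 : R) < q%:R. Proof. by rewrite ltr0n ltnW. Qed.
Let q1 : (1 : R) < q%:R. Proof. by rewrite ltr1n. Qed.
Let lnq : 0 < ln (q%:R : R). Proof. exact: ln_gt0. Qed.

Let Rb0 : 0 <= Rb. Proof. exact: (Rb_ge0 q2 nvP RbP). Qed.
Let lam_gt0 : 0 < cabs lam. Proof. exact: le_lt_trans lR. Qed.
Let lam0 : lam != 0. Proof. by rewrite -cabs_gt0. Qed.

Let chain_eigen : chain m *m Cmat q A = lam *: chain m.
Proof. by rewrite chainS (chain_nil wm (leqnn _)) addr0. Qed.

Let lam_le r : 0 < r -> Rb <= r -> cabs lam <= q%:R * r.
Proof. by move=> r0 Rbr; exact: (eigenvalue_jsr_bound q2 nvP RbP r0 Rbr chain_eigen w0). Qed.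

(* Every eigenvalue has modulus at most [q * Rb]: this excludes [Rb = 0] here,
   and in [eta_le1] it makes the Holder exponents at most 1, so that the Lipschitz
   factor [flow (- t)] does no harm. *)
Lemma Rb_gt0 : 0 < Rb.
Proof.
rewrite lt_def Rb0 andbT; apply/eqP => Rz.
have r0 : 0 < cabs lam / (2 * q%:R) by rewrite divr_gt0// mulr_gt0.
have := @lam_le _ r0 _; rewrite Rz => /(_ (ltW r0)).
have -> : q%:R * (cabs lam / (2 * q%:R)) = cabs lam / 2.
  by field; rewrite gt_eqF.
by move: lam_gt0; lra.
Qed.

Lemma eta_gt0 : 0 < eta.
Proof. by rewrite /logq divr_gt0// ln_gt0// ltr_pdivlMr ?Rb_gt0// mul1r. Qed.

Lemma eta_le1 : eta <= 1.
Proof.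
have lR0 : 0 < cabs lam / Rb by rewrite divr_gt0// Rb_gt0.
rewrite /logq ler_pdivrMr// mul1r ler_ln ?posrE//.
by rewrite ler_pdivrMr ?Rb_gt0//; apply: lam_le; rewrite ?Rb_gt0.
Qed.

Let flowS : flow 1 = Lambda. Proof. exact: flow1. Qed.

Lemma flow_contraction mu : 0 < mu < cabs lam -> exists2 c, 0 <= c &
  forall n, mxn (flow (- n%:R)) <= c * mu ^- n.
Proof.
move=> /andP[mu0 mul]; have [c c0 hc] := flow_bound m lam0.
have x1 : 1 < cabs lam / mu by rewrite ltr_pdivlMr// mul1r.
have [p p0 hp] := polynomial_le_geometric m x1.
exists (c * p) => [|n]; first by rewrite mulr_ge0// ltW.
apply: le_trans (hc _) _; rewrite normrN normr_nat powR_invn ?cabs_ge0// -!mulrA ler_wpM2l//.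
apply: (@le_trans _ _ ((p * (cabs lam / mu) ^+ n) * cabs lam ^- n)).
  rewrite ler_wpM2r ?invr_ge0 ?exprn_ge0 ?(ltW lam_gt0)//.
  by have := hp n; rewrite -natr1 addrC.
rewrite expr_div_n le_eqVlt; apply/orP; left; apply/eqP; field.
by rewrite !gt_eqF ?exprn_gt0.
Qed.

Lemma fluctuation_flow N : (0 < N)%N -> fluct (q * N) = flow 1 *m fluct N.
Proof. by rewrite flowS; exact: (fluctuation_qM q2 Tu TCJ Jj wm). Qed.

(** Since q^al < |lam| / R, some r above R keeps mu = r q^al below |lam|; the ratio r/mu is then
    q^(-al). *)
Let rates al : 0 < al < eta -> exists r mu c1 c2 : R,
  [/\ 0 < r, r < mu, 0 <= c1, 0 <= c2 & r / mu = q%:R `^ (- al)] /\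
  [/\ (forall N, (q <= N)%N ->
        mxn (fluct N - flow 1 *m fluct (N %/ q)) <= c1 * r ^+ trunc_log q N),
      (forall N, (0 < N)%N ->
        mxn (fluct N.+1 - fluct N) <= c1 * r ^+ trunc_log q N) &
      (forall n, mxn (flow (- n%:R)) <= c2 * mu ^- n)].
Proof.
move=> /andP[al0 ale]; have Rp := Rb_gt0.
have qa0 : 0 < q%:R `^ al by rewrite powR_gt0.
have qal : q%:R `^ al < cabs lam / Rb.
  have lR0 : 0 < cabs lam / Rb by rewrite divr_gt0.
  rewrite powR_ln// -[ltRHS]lnK ?posrE// ltr_expR.
  by move: ale; rewrite /logq ltr_pdivlMr.
have Rl : Rb < cabs lam / q%:R `^ al.
  by rewrite ltr_pdivlMr// mulrC -ltr_pdivlMr.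
pose r := (Rb + cabs lam / q%:R `^ al) / 2.
have Rr : Rb < r by rewrite /r; lra.
have rl : r < cabs lam / q%:R `^ al by rewrite /r; lra.
have r0 : 0 < r by exact: lt_trans Rr.
pose mu := r * q%:R `^ al.
have mul : mu < cabs lam by rewrite /mu -ltr_pdivlMr.
have rmu : r < mu.
  rewrite /mu ltr_pMr// -[ltLHS](powRr0 q%:R) !powR_ln// ltr_expR mul0r.
  exact: mulr_gt0.
have [cf cf0 hf] := fseq_bound q2 nvP RbP r0 (ltW Rr).
(* For [lam] = 1 the eigenvalue bound reads 1 <= q R, and R < r makes it strict. *)
have hr : lam = 1 -> 1 < q%:R * r.
  move=> l1; apply: (@le_lt_trans _ _ (q%:R * Rb)); last by rewrite ltr_pM2l.
  by have := lam_le Rp (lexx _); rewrite l1 cabs1.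
have [c1 c10 [h1 h2]] := fluctuation_bounds q2 Tu TCJ Jj wm r0 hr cf0 hf.
have [|c2 c20 h3] := @flow_contraction mu.
  by rewrite mul andbT mulr_gt0.
exists r, mu, c1, c2; split; split.
- exact: r0.
- exact: rmu.
- exact: c10.
- exact: c20.
- by rewrite /mu powRN invfM mulrA divff ?gt_eqF// mul1r.
- by move=> N qN; rewrite flowS; exact: h1.
- exact: h2.
- exact: h3.
Qed.

(** Where some rate of convergence is enough, the exponent eta / 2 is taken. *)
Let eta2 : 0 < eta / 2 < eta.
Proof. by have := eta_gt0; lra. Qed.

Definition limit_profile : R -> 'M[R[i]]_(m.+1, d) := profile q flow fluct.

Definition periodic_part (t : R) := flow (- t) *m limit_profile t.

Lemma periodic_partS t : 0 <= t <= 1 -> periodic_part (t + 1) = periodic_part t.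
Proof.
move=> t01; have [r [mu [c1 [c2 [[r0 rmu c10 c20 _] [h1 h2 h3]]]]]] := rates eta2.
rewrite /periodic_part /limit_profile.
rewrite (profileS q2 (@flowD R m lam) r0 rmu c10 c20 h1 h3 t01).
rewrite mulmxA; congr (_ *m _).
by rewrite -(flowD m lam (- (t + 1)) 1) opprD subrK.
Qed.

Lemma fluctuation_periodic N : (0 < N)%N ->
  fluct N = flow (logq q N%:R) *m periodic_part (fracpart (logq q N%:R)).
Proof.
move=> N0; have [r [mu [c1 [c2 [[r0 rmu c10 c20 _] [h1 h2 h3]]]]]] := rates eta2.
have /andP[t0 t1] := trunc_log_logq R q2 N0.
have -> : fracpart (logq q N%:R) = logq q N%:R - (trunc_log q N)%:R :> R.
  rewrite -[in LHS](subrK (trunc_log q N)%:R (logq q N%:R)) (fracpartDint _ (trunc_log q N)).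
  rewrite fracpart_id//; rewrite -natr1 in t1; apply/andP; split; lra.
rewrite /periodic_part /limit_profile.
rewrite (profile_nat q2 (flow0 m lam) (@flowD R m lam) fluctuation_flow
  r0 rmu c10 c20 h1 h3 N0).
set n := (trunc_log q N)%:R; set t := logq q N%:R.
rewrite (mulmxA (flow t)) (mulmxA (flow t *m _)).
rewrite -(flowD m lam t (- (t - n))) -(flowD m lam (t - (t - n)) (- n)).
by rewrite subKr subrr (flow0 m lam) mul1mx.
Qed.

Lemma periodic_part_holder al : 0 < al < eta -> holder al periodic_part.
Proof.
move=> ale; have [r [mu [c1 [c2 [[r0 rmu c10 c20 e] [h1 h2 h3]]]]]] := rates ale.
have al01 : 0 < al <= 1.
  by have := eta_le1; move: ale => /andP[-> +]; move=> h h'; rewrite ltW// (lt_le_trans h).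
apply: (holderM al01); first exact: flow_holder.
have al0 : 0 < al by case/andP: ale.
exact: (profile_holder q2 (@flowD R m lam) r0 rmu c10 c20 h1 h2 h3 al0 e).
Qed.

(** The sum is the coefficient of t^k in the first row of lam^(-t) flow(t) Pi, with Pi the periodic
    part: row j of Pi enters with (t choose j) lam^(-j). The lower-order terms of sigma can be added
    because they vanish unless [lam] = 1, and then N^(log_q lam) = 1. *)
Definition Phi_coef (k : nat) (u : R) : 'rV[R[i]]_d :=
  \sum_(j < m.+1) ((binp _ j)`_k * lam ^- j) *: row j (periodic_part (fracpart u)) +
  smooth_coef q m A w lam k.

Lemma Phi_periodic k u : Phi_coef k (u + 1) = Phi_coef k u.
Proof. by rewrite /Phi_coef (fracpartDint u 1). Qed.

Lemma Phi_holder k al : 0 < al < eta -> exists2 L, 0 <= L &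
  forall x y, nv (Phi_coef k x - Phi_coef k y) <= L * `|x - y| `^ al.
Proof.
move=> ale; have al01 : 0 < al <= 1.
  by have := eta_le1; move: ale => /andP[-> +]; move=> h h'; rewrite ltW// (lt_le_trans h).
have [L L0 hL] := periodic_holder al01 periodic_partS (periodic_part_holder ale).
have [c c0 hc] := vnorm_le_mxn nvP.
pose s : R := \sum_(j < m.+1) cabs ((binp R[i] j)`_k * lam ^- j).
have s0 : 0 <= s by apply: sumr_ge0 => j _; exact: cabs_ge0.
exists (c * (s * L)) => [|x y]; first by rewrite !mulr_ge0// ltW.
apply: le_trans (hc _) _; rewrite -mulrA ler_wpM2l ?(ltW c0)//.
have := hL x y; rewrite /Phi_coef.
move: (periodic_part _) (periodic_part _) (smooth_coef _ _ _ _ _ _) => X Y sc h.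
rewrite opprD addrACA subrr addr0 -sumrB -mulrA mulr_suml.
apply: le_trans (mxn_sum _ _ _) _; apply: ler_sum => j _.
rewrite -scalerBr mxnZ ler_wpM2l ?cabs_ge0//; apply: le_trans h.
by rewrite -linearB mxn_row.
Qed.

Lemma Phi_continuous k x e : 0 < e -> exists2 delta : R, 0 < delta &
  forall y : R, `|y - x| < delta -> nv (Phi_coef k y - Phi_coef k x) < e.
Proof.
move=> e0; have [L L0 hL] := Phi_holder k eta2.
have a0 : 0 < eta / 2 by case/andP: eta2.
have L1 : 0 < L + 1 by rewrite ltr_wpDl.
have eL : 0 < e / (L + 1) by rewrite divr_gt0.
(* Solves (L + 1) delta^(eta/2) = e; L + 1 is positive even if L = 0. *)
exists ((e / (L + 1)) `^ (eta / 2)^-1); first exact: powR_gt0.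
move=> y hy; apply: le_lt_trans (hL y x) _.
have : `|y - x| `^ (eta / 2) < e / (L + 1).
  have -> : e / (L + 1) = ((e / (L + 1)) `^ (eta / 2)^-1) `^ (eta / 2).
    by rewrite -powRrM mulVf ?gt_eqF// powRr1// ltW.
  by apply: gt0_ltr_powR; rewrite ?nnegrE ?powR_ge0.
rewrite ltr_pdivlMr// mulrC; apply: le_lt_trans; rewrite ler_wpM2r ?powR_ge0//.
by rewrite lerDl.
Qed.

Lemma rpowc_logq N : rpowc N%:R (cLog lam / RC (ln q%:R)) = cexp (RC (logq q N%:R) * cLog lam).
Proof.
rewrite /rpowc /logq; congr cexp; rewrite -/(RC _) RCM.
have -> : RC (ln q%:R)^-1 = (RC (ln (q%:R : R)))^-1 by rewrite /RC fmorphV.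
by rewrite [RHS]mulrC -mulrA [in RHS](mulrC (RC _)).
Qed.

Lemma expansion N : (0 < N)%N -> w *m Fsum q A N =
  (w *m Kmat T J (A 0%N) + RC (logq q N%:R ^+ m.+1) *:
     (w *m theta T J (Cmat q A) (A 0%N) m.+1)) +
  rpowc N%:R (cLog lam / RC (ln q%:R)) *:
    \sum_(k < m.+1) RC (logq q N%:R ^+ k) *: Phi_coef k (fracpart (logq q N%:R)).
Proof.
move=> N0; apply/eqP; rewrite addrC -subr_eq; apply/eqP.
rewrite (main_difference Tu TCJ Jj wm) (fluctuation_periodic N0) rpowc_logq.
set t := logq q N%:R.
have fr : fracpart (fracpart t) = fracpart t :> R.
  by rewrite fracpart_id// fracpart_itv.
rewrite /Phi_coef fr; set Pi := periodic_part _.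
under [X in _ = _ *: X]eq_bigr do rewrite scalerDr.
rewrite big_split scalerDr; congr (_ + _); last first.
  rewrite /smooth_coef; have [->|l1] := eqVneq lam 1.
    by rewrite cLog1 mulr0 cexp0 scale1r.
  by rewrite !big1 ?scaler0// => j _; rewrite scaler0.
rewrite -scalemxAl linearZ /=; congr (_ *: _).
rewrite /unipow mulmx_suml linear_sum /=.
transitivity (\sum_(j < m.+1) ((binp R[i] j).[RC t] * lam ^- j) *: row j Pi).
  apply: eq_bigr => j _; rewrite -scalemxAl linearZ /= exprZn -scalemxAl linearZ /=.
  by rewrite row_shiftmxX add0n valK scalerA exprVn.
transitivity (\sum_(j < m.+1) \sum_(k < m.+1)
    RC (t ^+ k) *: (((binp R[i] j)`_k * lam ^- j) *: row j Pi)).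
  apply: eq_bigr => j _.
  have -> : (binp R[i] j).[RC t] = \sum_(k < m.+1) (binp R[i] j)`_k * RC t ^+ k.
    exact: binp_expand.
  rewrite mulr_suml scaler_suml; apply: eq_bigr => k _.
  by rewrite scalerA RCX; congr (_ *: _); rewrite mulrAC mulrC.
by rewrite exchange_big; apply: eq_bigr => k _; rewrite scaler_sumr.
Qed.

(** * A common left eigenvector with eigenvalue 1 *)

Section FixedEigenvector.
Hypothesis fixA : forall r, (r < q)%N -> chain m *m A r = chain m.

Lemma fixed_eigenvalue : lam = RC q%:R.
Proof.
have : chain m *m Cmat q A = RC q%:R *: chain m.
  rewrite /Cmat mulmx_sumr (eq_bigr (fun=> chain m)) => [|r _]; last exact: fixA.
  by rewrite sumr_const card_ord RC_nat scaler_nat.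
rewrite chain_eigen => /eqP; rewrite -subr_eq0 -scalerBl scaler_eq0 (negbTE w0) orbF.
by rewrite subr_eq0 => /eqP.
Qed.

Let lam1 : lam != 1.
Proof.
rewrite fixed_eigenvalue RC_nat -[1]/(1%:R) eqr_nat; apply/eqP => q11.
by move: q2; rewrite q11.
Qed.

Let fixK : chain m *m Kmat T J (A 0%N) = 0.
Proof.
have := Kmat_fixpoint (A 0%N) Tu TCJ Jj lam1 (chain_gen wm m).
rewrite chain_eigen mulmxBr mulmx1 fixA ?(ltnW q2)// subrr addr0 -scalemxAl => /eqP.
rewrite -subr_eq0 -{1}[_ *m _]scale1r -scalerBl scaler_eq0 subr_eq0 eq_sym.
by rewrite (negbTE lam1) => /eqP.
Qed.

Let fix_fseq N : chain m *m fseq q A N = chain m.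
Proof.
rewrite fseq_natprodw; move: (ndigits q N) => n.
elim: n => [|n IHn]; first by rewrite natprodw0 mulmx1.
by rewrite -(addn1 n) natprodwD natprodw1 mulmxA IHn fixA// ltn_mod ltnW.
Qed.

(** The last chain vector is fixed by every f(n), so its row of V F(N) merely counts the summands;
    by [fixK] nothing is subtracted. *)
Let row_fluct N : row ord_max (fluct N) = N%:R *: chain m.
Proof.
rewrite /fluctuation /smooth_part (negbTE lam1) addr0 linearB /= !row_mul !row_chainmx.
rewrite fixK subr0 /Fsum mulmx_sumr (eq_bigr (fun=> chain m)) => [|n _]; last exact: fix_fseq.
by rewrite sumr_const card_ord scaler_nat.
Qed.

Let row_flow t (M : 'M[R[i]]_(m.+1, d)) :
  row ord_max (flow t *m M) = RC (q%:R `^ t) *: row ord_max M.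
Proof.
have -> : RC (q%:R `^ t) = cexp (RC t * cLog lam).
  rewrite fixed_eigenvalue cLog_pos// -RCM powR_ln//.
  by rewrite cexp_RC.
rewrite -scalemxAl linearZ /= /unipow mulmx_suml linear_sum /=; congr (_ *: _).
rewrite big_ord_recl binp0 scale1r expr0 mul1mx big1 ?addr0// => j _.
rewrite -scalemxAl linearZ /= exprZn -scalemxAl linearZ /= row_shiftmxX.
case: insubP => [k|]; last by rewrite !scaler0.
by rewrite /= /bump add1n addnS ltnS -ltn_subRL subnn.
Qed.

(** The last row of the n-th approximant is q^(-n) floor(q^(n+t)) times the eigenvector, and the
    factor tends to q^t. *)
Lemma row_limit_profile t : 0 <= t <= 2 ->
  row ord_max (limit_profile t) = RC (q%:R `^ t) *: chain m.
Proof.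
move=> t02; have [r [mu [c1 [c2 [[r0 rmu c10 c20 e] [h1 h2 h3]]]]]] := rates eta2.
have [c c0 hc] := profile_rate q2 (@flowD R m lam) r0 rmu c10 c20 h1 h3.
have mu0 : 0 < mu by exact: lt_trans rmu.
have th01 : 0 <= r / mu < 1.
  by rewrite divr_ge0 ?ltW//= ltr_pdivrMr// mul1r.
apply/subr0_eq/mxn_eq0; apply: (geometric_le0 (c := c + mxn (chain m)) (k := 0) th01) => n _.
pose s : R[i] := RC (q%:R `^ (- n%:R) * (scale_floor q n t)%:R).
have rn : row ord_max (renorm q flow fluct t n) = s *: chain m.
  by rewrite /renorm row_flow row_fluct scalerA /s RCM RC_nat.
have -> : row ord_max (limit_profile t) - RC (q%:R `^ t) *: chain m =
   - row ord_max (renorm q flow fluct t n - limit_profile t) + (s - RC (q%:R `^ t)) *: chain m.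
  by rewrite linearB /= rn opprB scalerBl addrA subrK.
apply: le_trans (mxnD _ _) _; rewrite mulrDl; apply: lerD.
  by rewrite mxnN; apply: le_trans (mxn_row _ _) _; exact: hc.
rewrite mxnZ mulrC ler_wpM2l ?mxn_ge0// -RCN -RCD cabs_real.
have /andP[lo hi] := scale_floor_itv q n t.
have qn0 : 0 < q%:R `^ n%:R :> R by exact: powR_gt0.
have qD : q%:R `^ (n%:R + t) = q%:R `^ n%:R * q%:R `^ t :> R.
  by rewrite powRD// (gt_eqF q0) implybT.
have -> : q%:R `^ (- n%:R) * (scale_floor q n t)%:R - q%:R `^ t =
    - ((q%:R `^ (n%:R + t) - (scale_floor q n t)%:R) / q%:R `^ n%:R) :> R.
  by rewrite qD powRN; field; rewrite gt_eqF.
rewrite normrN ger0_norm; last by rewrite divr_ge0 ?subr_ge0// ltW.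
apply: (@le_trans _ _ (q%:R `^ n%:R)^-1).
  by rewrite ler_pdivrMr// mulVf ?gt_eqF// lerBlDl natr1 ltW.
(* The rounding error is at most q^(-n), and (r/mu)^n = q^(-n eta/2) is no smaller because eta / 2
   <= 1. *)
rewrite e -powR_mulrn ?powR_ge0// -powRrM -powRN; apply: ler_powR; first exact: ltW.
rewrite mulNr lerN2 ler_piMl//.
have := eta_le1; have := eta_gt0; lra.
Qed.

(** Only (t choose m) reaches t^m, with coefficient 1/m!; lam^(-m) is q^(-m), and the factors q^(-t)
    of the flow and q^t of the profile cancel. *)
Lemma Phi_fixed u : Phi_coef m u = ((q ^ m * m`!)%:R)^-1 *: chain m.
Proof.
rewrite /Phi_coef /smooth_coef (negbTE lam1) addr0 big_ord_recr /= big1 ?add0r; last first.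
  move=> j _; have sz : (size (binp R[i] j) <= m)%N.
    by apply: leq_trans (size_binp _ _) _.
  by rewrite (nth_default _ sz) mul0r scale0r.
have /andP[f0 f1] := fracpart_itv u.
have f02 : 0 <= fracpart u <= 2 by apply/andP; split; lra.
rewrite /periodic_part row_flow (row_limit_profile f02) scalerA -RCM -powRD; last first.
  by rewrite addNr eqxx /= gt_eqF.
rewrite addNr powRr0 scale1r lead_binp fixed_eigenvalue RC_nat natrM natrX invfM.
by congr (_ *: _); exact: mulrC.
Qed.

End FixedEigenvector.

End LargeEigenvalue.


Unset Implicit Arguments.
Set Strict Implicit.

Theorem theoremA1 (R : realType) (q d : nat) (A : nat -> 'M[R[i]]_d)
    (nv : 'rV[R[i]]_d -> R) (Rb : R) (T J : 'M[R[i]]_d)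
    (w : 'rV[R[i]]_d) (lam : R[i]) (m : nat) :
  (2 <= q)%N -> (1 <= d)%N -> is_vnorm nv ->
  (* choice of R *)
  (finiteness q nv A /\ Rb = jsr q nv A) \/
  (~ finiteness q nv A /\ jsr q nv A < Rb /\
     (forall mu : R[i], eigenvalue (Cmat q A) mu ->
        ~ (jsr q nv A < cabs mu /\ cabs mu <= Rb))) ->
  (* Jordan decomposition T C T^{-1} = J *)
  T \in unitmx -> T *m Cmat q A *m invmx T = J -> is_jordan J ->
  (* w is a generalised left eigenvector of rank m for lam *)
  (1 <= m)%N ->
  w *m (Cmat q A - lam%:M) ^+ m = 0 ->
  w *m (Cmat q A - lam%:M) ^+ m.-1 != 0 ->
  let C := Cmat q A in
  let K := Kmat T J (A 0%N) in
  let th := theta T J C (A 0%N) m in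
  let main := fun N : nat =>
      w *m K + RC ((logq q N%:R) ^+ m) *: (w *m th) in
  (* (1) *)
  (cabs lam < Rb ->
     exists (c : R) (N0 : nat), forall N : nat, (N0 <= N)%N ->
       nv (w *m Fsum q A N - main N) <= c * Rb `^ (logq q N%:R)) /\
  (* (2) *)
  (cabs lam = Rb ->
     exists (c : R) (N0 : nat), forall N : nat, (N0 <= N)%N ->
       nv (w *m Fsum q A N - main N)
         <= c * (Rb `^ (logq q N%:R) * ln N%:R ^+ m)) /\
  (* (3) *)
  (Rb < cabs lam ->
     exists Phi : nat -> R -> 'rV[R[i]]_d,
       (forall k : nat, (k < m)%N ->
          [/\ (forall u : R, Phi k (u + 1) = Phi k u),
              (forall (x : R) (e : R), 0 < e -> exists2 delta : R, 0 < delta &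
                 forall y : R, `|y - x| < delta -> nv (Phi k y - Phi k x) < e) &
              (forall alpha : R, 0 < alpha -> alpha < logq q (cabs lam / Rb) ->
                 exists L : R, forall x y : R,
                   nv (Phi k x - Phi k y) <= L * `|x - y| `^ alpha)]) /\
       (forall N : nat, (q ^ m.-1 <= N)%N ->
          w *m Fsum q A N = main N
            + rpowc N%:R (cLog lam / RC (ln q%:R)) *:
                \sum_(k < m) RC ((logq q N%:R) ^+ (nat_of_ord k)) *: Phi k (fracpart (logq q N%:R))) /\
       ((forall r : nat, (r < q)%N ->
           (w *m (C - lam%:M) ^+ m.-1) *m A r = w *m (C - lam%:M) ^+ m.-1) ->
        forall u : R,
          Phi m.-1 u = ((q ^ m.-1 * (m.-1)`!)%:R)^-1 *: (w *m (C - q%:R%:M) ^+ m.-1))) /\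
  (* moreover *)
  (lam = 1 -> w *m K = 0) /\
  (lam != 1 -> w *m th = 0).
Proof.
move=> q2 _ nvP hRb Tu TCJ Jj; case: m => [//|n] _ wm w0 C K th main.
have RbP : (finiteness q nv A /\ Rb = jsr q nv A) \/ jsr q nv A < Rb.
  by case: hRb => [|[_ [? _]]]; [left|right].
split; first exact: (remainder_small q2 Tu TCJ Jj wm nvP RbP).
split; first exact: (remainder_critical q2 Tu TCJ Jj wm nvP RbP).
split.
  move=> lR; exists (Phi_coef q n A T J w lam); split; last split.
  - move=> k _; split.
    + by move=> u; exact: Phi_periodic.
    + by move=> x e; exact: (Phi_continuous q2 Tu TCJ Jj wm w0 nvP RbP lR).
    + move=> al al0 ale.
      have [|L _ hL] := Phi_holder q2 Tu TCJ Jj wm w0 nvP RbP lR k (al := al).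
        by rewrite al0 ale.
      by exists L.
  - move=> N hN; apply: (expansion q2 Tu TCJ Jj wm w0 nvP RbP lR).
    by apply: leq_trans hN; rewrite expn_gt0 ltnW.
  - move=> fixA u.
    rewrite (Phi_fixed q2 Tu TCJ Jj wm w0 nvP RbP lR fixA) /chain.
    by rewrite {1}(fixed_eigenvalue wm w0 fixA) RC_nat.
split=> [l1|l1]; first by apply: (Kmat_eigen1 _ Tu TCJ Jj (k := n.+1)); rewrite -l1.
by rewrite /th (thetaE _ Tu TCJ Jj n.+1 wm) (negbTE l1).
Qed.
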